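(* Let $R$ be a commutative ring with an $R$-regular sequence $\boldsymbol{x}=x_1,\cdots,x_d$, and let $M$ be a nonexact complex in $\mathrm{D}_\Box(R/(\boldsymbol{x}))$ with $\mathrm{qpd}_{R}M<\infty$. Suppose that either of the following conditions holds: (1) $R$ is von Neumann regular. (2) $\mathrm{Ext}^{1}_R(\mathrm{H}(M),\mathrm{H}(M))=0$. Then $\mathrm{qpd}_{R/(\boldsymbol{x})}M\leq\mathrm{qpd}_{R}M-d$.
   Context: For a ring $S$, $\mathrm{D}_\Box(S)$ is the full subcategory of the derived category of $S$-complexes (homologically graded chain complexes of $S$-modules) consisting of complexes with bounded homology. A complex over $R/(\boldsymbol x)$ is regarded as an $R$-complex by restriction of scalars. $\mathrm{H}_n$ denotes homology and $\mathrm{H}(M)=\bigoplus_n\mathrm{H}_n(M)$ (in $\mathrm{Ext}^1_R(\mathrm{H}(M),\mathrm{H}(M))$ it is the $R$-module $\bigoplus_n\mathrm{H}_n(M)$); $\sup P=\sup\{i:P_i\neq0\}$, $\mathrm{hsup}P=\sup\{i:\mathrm{H}_i(P)\ne0\}$, and $\Sigma$ is the shift with $\mathrm{H}_n(\Sigma^iM)=\mathrm{H}_{n-i}(M)$. For a ring $S$, an $S$-complex $P$ is semi-projective if $\mathrm{Hom}_S(P,\beta)$ is a surjective quasi-isomorphism for every surjective quasi-isomorphism $\beta$ of $S$-complexes. A quasi-projective resolution of an $S$-complex $M$ is a semi-projective $S$-complex $P$ for which there are an integer $\ell$ and integers $a_i\ge0$ ($i\ge\ell$), not all zero, with $\mathrm{H}(P)\cong\bigoplus_{i=\ell}^\infty\mathrm{H}(\Sigma^iM^{a_i})$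 (as graded modules). $\mathrm{qpd}_SM$ is the infimum of $\sup P-\mathrm{hsup}P$ over all bounded above (i.e. $P_v=0$ for $v\gg0$) quasi-projective resolutions $P$ of $M$ if $M$ is not exact ($\infty$ if there are none), and $-\infty$ if $M$ is exact. *)

(* Defs.v *)
From HB Require Import structures.
From mathcomp Require Import all_boot all_order all_algebra.
From mathcomp Require Import ring_quotient.
From mathcomp Require Import boolp classical_sets functions cardinality.
From mathcomp Require Import constructive_ereal.

Set Implicit Arguments.
Unset Strict Implicit.
Unset Printing Implicit Defensive.

Import Order.TTheory GRing.Theory Num.Theory.
Local Open Scope ring_scope.
Local Open Scope quotient_scope.

Section Modules.
Variable S : comPzRingType.

Definition zero_module (V : lmodType S) : Prop := forall v : V, v = 0.

Definition module_iso (U V : lmodType S) : Prop :=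
  exists f : {linear U -> V}, bijective f.

Definition projective_module (P : lmodType S) : Prop :=
  forall (U V : lmodType S) (g : {linear U -> V}) (f : {linear P -> V}),
    (forall v, exists u, g u = v) ->
    exists h : {linear P -> U}, forall p, g (h p) = f p.

End Modules.

Section DirectProduct.
Variables (S : comPzRingType) (I : Type) (V : I -> lmodType S).

Definition dprod : Type := forall i, V i.

HB.instance Definition _ := gen_eqMixin dprod.
HB.instance Definition _ := gen_choiceMixin dprod.

Let add (f g : dprod) : dprod := fun i => f i + g i.
Let opp (f : dprod) : dprod := fun i => - f i.
Let zero : dprod := fun i => 0.
Let scale (a : S) (f : dprod) : dprod := fun i => a *: f i.

Let addA : associative add.
Proof. by move=> f g h; apply: functional_extensionality_dep => i; exact: addrA. Qed.
Let addC : commutative add.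
Proof. by move=> f g; apply: functional_extensionality_dep => i; exact: addrC. Qed.
Let add0 : left_id zero add.
Proof. by move=> f; apply: functional_extensionality_dep => i; exact: add0r. Qed.
Let addN : left_inverse zero opp add.
Proof. by move=> f; apply: functional_extensionality_dep => i; exact: addNr. Qed.

HB.instance Definition _ := GRing.isZmodule.Build dprod addA addC add0 addN.

Let scaleA a b v : scale a (scale b v) = scale (a * b) v.
Proof. by apply: functional_extensionality_dep => i; exact: scalerA. Qed.
Let scale1 : left_id 1 scale.
Proof. by move=> f; apply: functional_extensionality_dep => i; exact: scale1r. Qed.
Let scaleDr : right_distributive scale +%R.
Proof. by move=> a f g; apply: functional_extensionality_dep => i; exact: scalerDr. Qed.
Let scaleDl v : {morph scale^~ v : a b / a + b}.
Proof. by move=> a b; apply: functional_extensionality_dep => i; exact: scalerDl. Qed.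

HB.instance Definition _ :=
  GRing.Zmodule_isLmodule.Build S dprod scaleA scale1 scaleDr scaleDl.

Lemma dprodD (f g : dprod) i : (f + g) i = f i + g i. Proof. by []. Qed.
Lemma dprodZ a (f : dprod) i : (a *: f) i = a *: f i. Proof. by []. Qed.
Lemma dprod0 i : (0 : dprod) i = 0. Proof. by []. Qed.

Definition finitely_supported : {pred dprod} :=
  fun f => `[< finite_set [set i | f i <> 0] >].

Lemma finitely_supported_submod : submod_closed finitely_supported.
Proof.
split.
  apply/asboolP; rewrite (_ : mkset _ = set0) //.
  by apply/seteqP; split => i //=; rewrite dprod0.
move=> a f g /asboolP ff /asboolP fg; apply/asboolP.
apply: (@sub_finite_set _ _ ([set i | f i <> 0] `|` [set i | g i <> 0])%classic).
  move=> i /=; rewrite dprodD dprodZ => h.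
  have [f0|?] := pselect (f i = 0); last by left.
  by right => g0; apply: h; rewrite f0 g0 scaler0 addr0.
by rewrite finite_setU.
Qed.

HB.instance Definition _ :=
  GRing.isSubmodClosed.Build S dprod finitely_supported finitely_supported_submod.

Record dsum : Type := DSum {
  dsum_val :> dprod;
  dsum_valP : dsum_val \in finitely_supported
}.

HB.instance Definition _ := [isSub for dsum_val].
HB.instance Definition _ := [Choice of dsum by <:].
HB.instance Definition _ := [SubChoice_isSubLmodule of dsum by <:].

End DirectProduct.

Section QuotientModule.
Variables (S : comPzRingType) (U : lmodType S) (B : submodClosed U).

Definition submod_pred : {pred U} := fun u => u \in B.

Let submod_pred_zmod : zmod_closed submod_pred.
Proof.
split=> [|u v uB vB]; first exact: (rpred0 B).
by rewrite -scaleN1r; apply: (@rpredD _ B) => //; exact: (@rpredZ _ _ B).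
Qed.

HB.instance Definition _ := GRing.isZmodClosed.Build U submod_pred submod_pred_zmod.

Definition quot_module : Type := Quotient.quot submod_pred.

HB.instance Definition _ := ZmodQuotient.on quot_module.

Let scale (a : S) : quot_module -> quot_module := lift_op1 quot_module ( *:%R a).

Let quot_eq (u v : U) :
  \pi_quot_module u = \pi_quot_module v <-> u - v \in B.
Proof.
have -> : (u - v \in B) = (u == v %[mod quot_module]).
  exact: (Quotient.idealrBE submod_pred).
by split => [->|/eqP].
Qed.

Let pi_scale a (u : U) : scale a (\pi u) = \pi_quot_module (a *: u).
Proof.
unlock scale; apply/quot_eq; rewrite -scalerBr.
by apply: (@rpredZ _ _ B); apply/quot_eq; rewrite reprK.
Qed.

Let scaleA a b v : scale a (scale b v) = scale (a * b) v.
Proof. by rewrite -[v]reprK !pi_scale scalerA. Qed.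
Let scale1 : left_id 1 scale.
Proof. by move=> v; rewrite -[v]reprK pi_scale scale1r. Qed.
Let scaleDr : right_distributive scale +%R.
Proof.
move=> a u v; rewrite -[u]reprK -[v]reprK !pi_scale.
by rewrite -!raddfD pi_scale scalerDr raddfD.
Qed.
Let scaleDl v : {morph scale^~ v : a b / a + b}.
Proof. by move=> a b; rewrite -[v]reprK !pi_scale scalerDl raddfD. Qed.

HB.instance Definition _ :=
  GRing.Zmodule_isLmodule.Build S quot_module scaleA scale1 scaleDr scaleDl.

Lemma quot_moduleZ a (u : U) : a *: \pi_quot_module u = \pi_quot_module (a *: u).
Proof. exact: pi_scale. Qed.

Lemma quot_module_eq (u v : U) :
  \pi_quot_module u = \pi_quot_module v <-> u - v \in B.
Proof. exact: quot_eq. Qed.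

End QuotientModule.

(* Homological grading: cdiff lowers the degree by one. It is a family indexed
   by all pairs of degrees, zero outside
   the pairs (j + 1, j), which avoids casts between C (n + 1 - 1) and C n. *)
Record complex (S : comPzRingType) : Type := Complex {
  cobj :> int -> lmodType S;
  cdiff : forall i j : int, {linear cobj i -> cobj j};
  cdiff_deg : forall i j x, i != j + 1 -> cdiff i j x = 0;
  cdiff_sq : forall i j k x, cdiff j k (cdiff i j x) = 0
}.

Section Homology.
Variables (S : comPzRingType) (M : complex S) (n : int).

Definition cycle_pred : {pred M n} := fun z => cdiff M n (n - 1) z == 0.

Lemma cycle_submod : submod_closed cycle_pred.
Proof.
split; first by rewrite unfold_in raddf0.
move=> a u v /eqP du /eqP dv.
by rewrite unfold_in linearP du dv scaler0 addr0.
Qed.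

HB.instance Definition _ :=
  GRing.isSubmodClosed.Build S (M n) cycle_pred cycle_submod.

Record cycles : Type := Cycle {
  cycle_val : M n;
  cycleP : cycle_val \in cycle_pred
}.

HB.instance Definition _ := [isSub for cycle_val].
HB.instance Definition _ := [Choice of cycles by <:].
HB.instance Definition _ := [SubChoice_isSubLmodule of cycles by <:].

Definition boundary_pred : {pred cycles} :=
  fun z => `[< exists y : M (n + 1), cdiff M (n + 1) n y = cycle_val z >].

Lemma boundary_submod : submod_closed boundary_pred.
Proof.
split; first by apply/asboolP; exists 0; rewrite raddf0.
move=> a u v /asboolP[x dx] /asboolP[y dy]; apply/asboolP.
by exists (a *: x + y); rewrite linearP dx dy.
Qed.

HB.instance Definition _ :=
  GRing.isSubmodClosed.Build S cycles boundary_pred boundary_submod.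

Definition homology : lmodType S := quot_module boundary_pred.

Definition homology_class (z : cycles) : homology := \pi_(quot_module boundary_pred) z.

End Homology.

Arguments cycle_pred {S} M n _ : rename.
Arguments boundary_pred {S} M n _ : rename.

Section ChainMaps.
Variable S : comPzRingType.

Record chain_map (M N : complex S) : Type := ChainMap {
  cmap :> forall n, {linear M n -> N n};
  cmap_diff : forall i j x, cmap j (cdiff M i j x) = cdiff N i j (cmap i x)
}.

Variables (M N : complex S) (f : chain_map M N).

Lemma cycle_map_subproof n (z : cycles M n) : f n (cycle_val z) \in cycle_pred N n.
Proof. by apply/eqP; rewrite -cmap_diff (eqP (cycleP z)) raddf0. Qed.

Definition cycle_map n (z : cycles M n) : cycles N n := Cycle (cycle_map_subproof z).

(* The induced map in homology: the choice of the representative is immaterial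
   by homology_mapE. *)
Definition homology_map n (h : homology M n) : homology N n :=
  homology_class (cycle_map (repr (h : quot_module (boundary_pred M n)))).

Lemma homology_mapE n (z : cycles M n) :
  homology_map (homology_class z) = homology_class (cycle_map z).
Proof.
apply/quot_module_eq; apply/asboolP.
have /quot_module_eq/asboolP[y dy] :
  homology_class (repr (homology_class z : quot_module _)) = homology_class z.
  exact: reprK.
by exists (f _ y); rewrite -cmap_diff dy /= raddfB.
Qed.

Definition quasi_iso : Prop := forall n, bijective (@homology_map n).

Definition surjective_map : Prop := forall n (y : N n), exists x, f n x = y.

End ChainMaps.

Section Constructions.
Variable S : comPzRingType.

Section Shift.
Variables (i : int) (M : complex S).

Let diff (p q : int) : {linear M (p - i) -> M (q - i)} :=
  ((-1) ^+ `|i|%N : S) \*: cdiff M (p - i) (q - i).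

Let diff_deg p q x : p != q + 1 -> diff p q x = 0.
Proof.
move=> pq; rewrite /diff /= cdiff_deg ?scaler0 //.
by rewrite addrAC (inj_eq (addIr _)).
Qed.

Let diff_sq p q r x : diff q r (diff p q x) = 0.
Proof. by rewrite /diff /= linearZ /= cdiff_sq !scaler0. Qed.

Definition cshift : complex S := Complex diff_deg diff_sq.

End Shift.

Section Power.
Variables (M : complex S) (a : nat).

Let diff (p q : int) (x : {ffun 'I_a -> M p}) : {ffun 'I_a -> M q} :=
  [ffun k => cdiff M p q (x k)].

Let diff_linear p q : linear (@diff p q).
Proof. by move=> b x y; apply/ffunP => k; rewrite !ffunE linearP. Qed.

HB.instance Definition _ p q :=
  GRing.isLinear.Build S {ffun 'I_a -> M p} {ffun 'I_a -> M q} _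
    (@diff p q) (@diff_linear p q).

Let diff_deg p q x : p != q + 1 -> @diff p q x = 0.
Proof. by move=> pq; apply/ffunP => k; rewrite !ffunE cdiff_deg. Qed.

Let diff_sq p q r x : @diff q r (@diff p q x) = 0.
Proof. by apply/ffunP => k; rewrite !ffunE cdiff_sq. Qed.

Definition cpower : complex S :=
  @Complex S (fun p => {ffun 'I_a -> M p}) (fun p q => @diff p q) diff_deg diff_sq.

End Power.

Section Stalk.
Variable B : lmodType S.

Definition stalk_obj (n : int) : lmodType S :=
  if n is Posz 0 then B else 'rV[S]_0.

Definition stalk : complex S :=
  @Complex S stalk_obj (fun _ _ => \0) (fun _ _ _ _ => erefl) (fun _ _ _ _ => erefl).

End Stalk.

Section HomComplex.
Variables (P X : complex S).

(* An element of Hom(P, X)_n is a family of linear maps P p -> X (p + n);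
   as for differentials, it is stored as a family indexed by all (p, q) that
   vanishes unless q = p + n. *)
Definition hom_family : lmodType S :=
  dprod (fun p : int => dprod (fun q : int => (P p -> X q : lmodType S))).

Definition hom_pred (n : int) : {pred hom_family} := fun f =>
  `[< (forall p q, linear (f p q)) /\
      (forall p q x, q != p + n -> f p q x = 0) >].

Lemma hom_submod n : submod_closed (hom_pred n).
Proof.
split.
  by apply/asboolP; split => // p q a x y; rewrite scaler0 addr0.
move=> a f g /asboolP[fl fd] /asboolP[gl gd]; apply/asboolP; split.
  move=> p q b x y.
  rewrite -[LHS]/(a *: f p q (b *: x + y) + g p q (b *: x + y)) fl gl.
  rewrite -[RHS]/(b *: (a *: f p q x + g p q x) + (a *: f p q y + g p q y)).
  by rewrite !scalerDr !scalerA mulrC addrACA.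
move=> p q x pq; rewrite -[LHS]/(a *: f p q x + g p q x).
by rewrite fd ?gd ?scaler0 ?addr0.
Qed.

HB.instance Definition _ n :=
  GRing.isSubmodClosed.Build S hom_family (hom_pred n) (hom_submod n).

Record hom (n : int) : Type := Hom {
  hom_val : hom_family;
  homP : hom_val \in hom_pred n
}.

Definition hom_fun n (f : hom n) : forall p q : int, P p -> X q := hom_val f.
Coercion hom_fun : hom >-> Funclass.

HB.instance Definition _ n := [isSub for @hom_val n].
HB.instance Definition _ n := [Choice of hom n by <:].
HB.instance Definition _ n := [SubChoice_isSubLmodule of hom n by <:].

Lemma hom_linear n (f : hom n) p q : linear (f p q).
Proof. by have /asboolP[] := homP f. Qed.

Lemma hom_deg n (f : hom n) p q x : q != p + n -> f p q x = 0.
Proof. by have /asboolP[_] := homP f; exact. Qed.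

Lemma hom_ext n (f g : hom n) : (forall p q x, f p q x = g p q x) -> f = g.
Proof.
move=> fg; apply: val_inj; apply: functional_extensionality_dep => p.
apply: functional_extensionality_dep => q.
by apply: functional_extensionality_dep => x; exact: fg.
Qed.

Lemma homZD n a (f g : hom n) p q x : (a *: f + g) p q x = a *: f p q x + g p q x.
Proof. by []. Qed.

Lemma hom0 n p q x : (0 : hom n) p q x = 0.
Proof. by []. Qed.

Let hom_raw0 n (f : hom n) p q : f p q 0 = 0.
Proof. by rewrite -[0](addNr 0) -scaleN1r hom_linear scaleN1r addNr. Qed.

(* d(f) = d^X o f - (-1)^n f o d^P for f of degree n. *)
Definition hom_diff_fun n m (f : hom n) : hom_family := fun p q x =>
  if n == m + 1 then
    cdiff X (q + 1) q (f p (q + 1) x)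
      - (-1) ^+ `|n|%N *: f (p - 1) q (cdiff P p (p - 1) x)
  else 0.

Arguments hom_diff_fun {n} m f p q x : rename.

Lemma hom_diff_subproof n m (f : hom n) : hom_diff_fun m f \in hom_pred m.
Proof.
apply/asboolP; split.
  move=> p q a x y; rewrite /hom_diff_fun; case: eqP => _; last first.
    by rewrite scaler0 addr0.
  rewrite !(linearP, hom_linear) !scalerDr /=.
  by rewrite addrACA.
move=> p q x pq; rewrite /hom_diff_fun; case: eqP => // nm.
rewrite hom_deg; last by rewrite nm addrA (inj_eq (addIr _)).
rewrite hom_deg; last by rewrite nm addrA addrAC subrK.
by rewrite raddf0 scaler0 subr0.
Qed.

Definition hom_diff n m (f : hom n) : hom m := Hom (hom_diff_subproof m f).

Lemma hom_diff_linear n m : linear (@hom_diff n m).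
Proof.
move=> a f g; apply: hom_ext => p q x.
rewrite homZD -[LHS]/(hom_diff_fun _ _ _ _ _).
rewrite -[(hom_diff m f) p q x]/(hom_diff_fun _ _ _ _ _).
rewrite -[(hom_diff m g) p q x]/(hom_diff_fun _ _ _ _ _).
rewrite /hom_diff_fun; case: eqP => _; last by rewrite scaler0 addr0.
rewrite !homZD linearP !scalerDr scalerN opprD !scalerA.
by rewrite [a * _]mulrC addrACA.
Qed.

HB.instance Definition _ n m :=
  GRing.isLinear.Build S (hom n) (hom m) _ (@hom_diff n m) (@hom_diff_linear n m).

Lemma hom_diff_deg n m (f : hom n) : n != m + 1 -> hom_diff m f = 0.
Proof.
move=> nm; apply: hom_ext => p q x.
by rewrite -[LHS]/(hom_diff_fun _ _ _ _ _) /hom_diff_fun (negbTE nm).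
Qed.

Lemma hom_diff_sq n m k (f : hom n) : hom_diff k (hom_diff m f) = 0.
Proof.
apply: hom_ext => p q x; rewrite hom0.
rewrite -[LHS]/(hom_diff_fun _ _ _ _ _) /hom_diff_fun; case: eqP => // mk.
rewrite -[(hom_diff m f) p (q + 1) x]/(hom_diff_fun _ _ _ _ _).
rewrite -[(hom_diff m f) (p - 1) q _]/(hom_diff_fun _ _ _ _ _).
rewrite /hom_diff_fun; case: eqP => nm; last by rewrite raddf0 scaler0 subrr.
rewrite linearB /= cdiff_sq cdiff_sq hom_raw0 scaler0 subr0 sub0r linearZ /=.
have -> : (-1) ^+ `|n|%N = - (-1) ^+ `|m|%N :> S.
  rewrite nm; case: (m) => [j|[|j]].
  - by rewrite -PoszD addn1 /= exprS mulN1r.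
  - by rewrite /= expr1 opprK.
  rewrite (_ : Negz j.+1 + 1 = Negz j);
    last by rewrite !NegzE -[j.+2]addn1 PoszD opprD addrNK.
  by rewrite -[`|Negz j.+1|%N]/(j.+2) exprS mulN1r opprK.
by rewrite scaleNr opprK subrr.
Qed.

Definition Hom_complex : complex S :=
  @Complex S (fun n => hom n) (fun n m => @hom_diff n m) hom_diff_deg hom_diff_sq.

End HomComplex.

Arguments hom_pred : clear implicits.
Arguments hom_diff_fun {P X n} m f p q x : rename.

Section HomMap.
Variables (P X Y : complex S) (b : chain_map X Y).

Definition hom_map_fun n (f : hom P X n) : hom_family P Y :=
  fun p q x => b q (f p q x).

Lemma hom_map_subproof n (f : hom P X n) : hom_map_fun f \in hom_pred P Y n.
Proof.
apply/asboolP; split=> [p q a x y|p q x pq]; rewrite /hom_map_fun.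
  by rewrite hom_linear linearP.
by rewrite hom_deg // raddf0.
Qed.

Definition hom_map n (f : hom P X n) : hom P Y n := Hom (hom_map_subproof f).

Lemma hom_map_linear n : linear (@hom_map n).
Proof.
move=> a f g; apply: hom_ext => p q x; rewrite homZD.
by rewrite -[LHS]/(b q ((a *: f + g) p q x)) homZD linearP.
Qed.

HB.instance Definition _ n :=
  GRing.isLinear.Build S (hom P X n) (hom P Y n) _ (@hom_map n) (@hom_map_linear n).

Lemma hom_map_diff n m (f : hom P X n) :
  hom_map (hom_diff m f) = hom_diff m (hom_map f).
Proof.
apply: hom_ext => p q x.
rewrite -[LHS]/(b q (hom_diff_fun m f p q x)).
rewrite -[RHS]/(hom_diff_fun m (hom_map f) p q x) /hom_diff_fun.
case: eqP => _; last by rewrite raddf0.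
by rewrite raddfB /= cmap_diff; congr (_ - _); exact: linearZ_LR.
Qed.

Definition Hom_complex_map : chain_map (Hom_complex P X) (Hom_complex P Y) :=
  @ChainMap S (Hom_complex P X) (Hom_complex P Y) (fun n => @hom_map n) hom_map_diff.

End HomMap.

End Constructions.

Arguments hom_pred {S} P X n : rename.
Arguments hom_diff_fun {S P X n} m f p q x : rename.

Section QuasiProjective.
Variable S : comPzRingType.

Definition semi_projective (P : complex S) : Prop :=
  forall (X Y : complex S) (b : chain_map X Y),
    surjective_map b -> quasi_iso b ->
    surjective_map (Hom_complex_map P b) /\ quasi_iso (Hom_complex_map P b).

Definition exact_complex (M : complex S) : Prop :=
  forall n, zero_module (homology M n).

Definition bounded_homology (M : complex S) : Prop :=
  exists a b : int, forall n, ~ zero_module (homology M n) -> a <= n <= b.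

Definition bounded_above (P : complex S) : Prop :=
  exists b : int, forall n, b < n -> zero_module (P n).

(* The direct sum over the integers i >= l of H(Sigma^i M^(a_i)) is indexed by
   the natural number k = i - l, and a k stands for a_(l + k). *)
Definition quasi_projective_resolution (M P : complex S) : Prop :=
  semi_projective P /\
  exists (l : int) (a : nat -> nat),
    (exists k, a k != 0%N) /\
    forall n, module_iso (homology P n)
      (dsum (fun k : nat => homology (cshift (l + k%:Z) (cpower M (a k))) n)).

(* Suprema and infima are taken in the complete lattice \bar int, so the first
   argument of supremum and infimum is their value at the empty set. *)
Definition sup_complex (P : complex S) : \bar int :=
  supremum -oo%E [set i%:E | i in [set i : int | ~ zero_module (P i)]].

Definition hsup (P : complex S) : \bar int :=
  supremum -oo%E [set i%:E | i in [set i : int | ~ zero_module (homology P i)]].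

Definition qpd (M : complex S) : \bar int :=
  if `[< exact_complex M >] then -oo%E
  else infimum +oo%E
    [set v | exists P : complex S,
      [/\ bounded_above P, quasi_projective_resolution M P &
          v = (sup_complex P - hsup P)%E]].

Definition total_homology (M : complex S) : lmodType S :=
  dsum (fun n : int => homology M n).

Definition projective_resolution (A : lmodType S) (P : complex S) : Prop :=
  [/\ forall n, projective_module (P n),
      forall n, n < 0 -> zero_module (P n),
      forall n, 0 < n -> zero_module (homology P n) &
      exists2 e : {linear P 0 -> A},
        forall v, exists x, e x = v &
        forall x, e x = 0 <-> exists y, cdiff P 1 0 y = x].

(* Ext^n(A, B) computed from a projective resolution P of A. *)
Definition Ext_via (P : complex S) (n : int) (B : lmodType S) : lmodType S :=
  homology (Hom_complex P (stalk B)) (- n).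

(* Every module has a projective resolution and Ext does not depend on it, so
   that "for some" and "for every" resolution agree. *)
Definition Ext_vanishes (n : int) (A B : lmodType S) : Prop :=
  exists2 P : complex S, projective_resolution A P & zero_module (Ext_via P n B).

End QuasiProjective.

Definition restr (R S : comPzRingType) (f : {rmorphism R -> S})
  (V : lmodType S) : Type := V.

Section Restriction.
Variables (R S : comPzRingType) (f : {rmorphism R -> S}).
Local Notation restr := (restr f).

Section RestrModule.
Variable V : lmodType S.

HB.instance Definition _ := GRing.Zmodule.on (restr V).

Let scale (a : R) (v : restr V) : restr V := f a *: (v : V).

Let scaleA a b v : scale a (scale b v) = scale (a * b) v.
Proof. by rewrite /scale scalerA rmorphM. Qed.
Let scale1 : left_id 1 scale.
Proof. by move=> v; rewrite /scale rmorph1 scale1r. Qed.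
Let scaleDr : right_distributive scale +%R.
Proof. by move=> a u v; exact: scalerDr. Qed.
Let scaleDl v : {morph scale^~ v : a b / a + b}.
Proof. by move=> a b; rewrite /scale rmorphD scalerDl. Qed.

HB.instance Definition _ :=
  GRing.Zmodule_isLmodule.Build R (restr V) scaleA scale1 scaleDr scaleDl.

End RestrModule.

Definition restr_fun (U V : lmodType S) (g : {linear U -> V}) : restr U -> restr V := g.

Let restr_linear (U V : lmodType S) (g : {linear U -> V}) : linear (restr_fun g).
Proof. by move=> a u v; exact: linearP. Qed.

HB.instance Definition _ (U V : lmodType S) (g : {linear U -> V}) :=
  GRing.isLinear.Build R (restr U) (restr V) _ (restr_fun g) (restr_linear g).

Definition restrict (M : complex S) : complex R :=
  @Complex R (fun n => restr (M n)) (fun i j => restr_fun (cdiff M i j))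
    (@cdiff_deg S M) (@cdiff_sq S M).

End Restriction.

Section RegularSequence.
Variables (R : comNzRingType) (d : nat) (x : d.-tuple R).

(* The ideal (x_0, ..., x_(k-1)). *)
Definition seq_ideal (k : nat) : {pred R} := fun r =>
  `[< exists c : 'I_d -> R, r = \sum_(i < d | (i < k)%N) c i * tnth x i >].

(* Each x_i is a nonzerodivisor on R / (x_0, ..., x_(i-1)), and R / (x) <> 0. *)
Definition regular_sequence : Prop :=
  (forall (i : 'I_d) r, tnth x i * r \in seq_ideal i -> r \in seq_ideal i) /\
  1 \notin seq_ideal d.

Hypothesis x_regular : regular_sequence.

Lemma seq_ideal_closed : idealr_closed (seq_ideal d).
Proof.
split; first by apply/asboolP; exists (fun=> 0); rewrite big1 // => i _; rewrite mul0r.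
  exact: x_regular.2.
move=> a u v /asboolP[b ->] /asboolP[c ->]; apply/asboolP.
exists (fun i => a * b i + c i); rewrite mulr_sumr -big_split /=.
by apply: eq_bigr => i _; rewrite mulrDl mulrA.
Qed.

Definition regular_ideal : idealr R :=
  HB.pack (seq_ideal d) (isIdealr.Build R (seq_ideal d) seq_ideal_closed).

End RegularSequence.

Definition quotient_ring (R : comNzRingType) (d : nat) (x : d.-tuple R)
    (x_regular : regular_sequence x) : comNzRingType :=
  Quotient.quot (regular_ideal x_regular).

Definition quotient_map (R : comNzRingType) (d : nat) (x : d.-tuple R)
    (x_regular : regular_sequence x) :
    {rmorphism R -> quotient_ring x_regular} :=
  \pi_(Quotient.quot (regular_ideal x_regular)).

Definition von_neumann_regular (R : pzRingType) : Prop :=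
  forall a : R, exists b : R, a = a * b * a.

(* Main.v *)
From HB Require Import structures.
From mathcomp Require Import all_boot all_order all_algebra.
From mathcomp Require Import finmap ring_quotient.
From mathcomp Require Import boolp classical_sets cardinality fsbigop.
From mathcomp Require Import constructive_ereal.
Require Import Defs.

(** Let [P] be a bounded above quasi-projective resolution of [M] over [R], and
    consider the quotients [P / (x_0, ..., x_(k-1)) P] for [k = 0, ..., d].

    The modules of a semi-projective complex are projective
    ([semi_projective_section]), so they are summands of free modules and [x] is
    a weakly regular sequence on them ([semi_projective_regular]). Multiplication
    by [x_k] on the [k]-th quotient is therefore injective with cokernel the next
    quotient. It acts by zero in homology, because the homology of the [k]-th
    quotient is, by induction, a sum of shifted copies of that of [M], which is
    killed by [x]. The long exact sequence
    breaks up into short exact sequences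
    [0 -> H_n(C) -> H_n(D) -> H_(n-1)(C) -> 0] for consecutive quotients [C] and
    [D]. In each degree the outer terms are summands of finite powers of the total
    homology of [M], since the homology of [M] is bounded; the vanishing of [Ext^1]
    splits the sequence ([Ext1_extensions_split]). Hence the homology of every
    quotient is again a sum of shifted copies of that of [M], and its top degree
    goes up by one at each of the [d] steps ([koszul_power_sum], [koszul_top]).

    The last quotient is a complex over [R / (x)]. It is semi-projective there, by
    the adjunction between base change and restriction of scalars
    ([descend_semi_projective]), so it is a quasi-projective resolution of [M] over
    [R / (x)]; its top degree is at most that of [P], and the top degree of its
    homology is that of [P] plus [d] ([reduction_resolution]). The inequality
    follows, as the quasi-projective dimension over [R] is attained
    ([qpd_attained]).

    When [R] is von Neumann regular a regular sequence is empty
    ([von_neumann_regular_empty]), so that there is no exact sequence to split. *)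

Set Implicit Arguments.
Unset Strict Implicit.
Unset Printing Implicit Defensive.

Import Order.TTheory GRing.Theory Num.Theory.
Local Open Scope ring_scope.
Local Open Scope quotient_scope.

(** * Linear maps given by relations, and direct sums *)

Section LinearRelations.
Variable S : comPzRingType.

Definition mk_linear (U V : lmodType S) (f : U -> V) (f_lin : linear f) :
    {linear U -> V} :=
  HB.pack f (GRing.isLinear.Build S U V _ f f_lin).

Lemma surjective_section_fun (U V : Type) (f : U -> V) :
  (forall v, exists u, f u = v) -> exists g : V -> U, cancel g f.
Proof. by move=> /(@choice _ _ (fun v u => f u = v)) [g gK]; exists g. Qed.

Lemma injective_surjective_bijective (U V : Type) (f : U -> V) :
  injective f -> (forall v, exists u, f u = v) -> bijective f.
Proof.
by move=> f_inj /surjective_section_fun[g gK]; exists g => // u; apply: f_inj; rewrite gK.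
Qed.

Lemma linear_injective (U V : lmodType S) (f : {linear U -> V}) :
  (forall u, f u = 0 -> u = 0) -> injective f.
Proof.
move=> f0 u v fuv; apply/subr0_eq/f0; by rewrite raddfB /= fuv subrr.
Qed.

Definition linear_relation (U V : lmodType S) (r : U -> V -> Prop) : Prop :=
  forall a u u' v v', r u v -> r u' v' -> r (a *: u + u') (a *: v + v').

(** Maps out of a homology module are described on representatives. A relation
    that ranges over all choices of representatives needs no canonical one: its
    value at [0] is the only thing to check, by linearity. *)
Lemma linear_of_relation (U V : lmodType S) (r : U -> V -> Prop) :
  linear_relation r -> (forall u, exists v, r u v) -> (forall v, r 0 v -> v = 0) ->
  exists f : {linear U -> V}, forall u v, r u v <-> v = f u.
Proof.
move=> r_lin r_tot r0.
have [f rf] := @choice _ _ _ r_tot.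
have r_fun u v v' : r u v -> r u v' -> v = v'.
  move=> uv uv'; apply/esym/subr0_eq/r0.
  have := r_lin (-1) _ _ _ _ uv uv'.
  by rewrite !scaleN1r addNr addrC.
have f_lin : linear f.
  by move=> a u u'; apply: r_fun (rf _) (r_lin _ _ _ _ _ (rf _) (rf _)).
exists (mk_linear f_lin) => u v; split => [uv|->]; last exact: rf.
exact: r_fun uv (rf u).
Qed.

Lemma module_iso_of_relation (U V : lmodType S) (r : U -> V -> Prop) :
  linear_relation r ->
  (forall u, exists v, r u v) -> (forall v, exists u, r u v) ->
  (forall v, r 0 v -> v = 0) -> (forall u, r u 0 -> u = 0) ->
  module_iso U V.
Proof.
move=> r_lin r_tot r_surj r0l r0r.
have [f rf] := linear_of_relation r_lin r_tot r0l.
exists f; apply: injective_surjective_bijective.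
  by apply: linear_injective => u fu; apply/r0r/rf.
by move=> v; have [u /rf->] := r_surj v; exists u.
Qed.

Lemma module_iso_refl (U : lmodType S) : module_iso U U.
Proof. by exists idfun; exists id. Qed.

Lemma module_iso_sym (U V : lmodType S) : module_iso U V -> module_iso V U.
Proof.
case=> f [g fK gK]; apply: (@module_iso_of_relation _ _ (fun v u => v = f u)).
- by move=> a v v' u u' -> ->; rewrite linearP.
- by move=> v; exists (g v); rewrite gK.
- by move=> u; exists (f u).
- by move=> u fu; rewrite -[u]fK -fu -(raddf0 f) fK.
- by move=> v ->; rewrite raddf0.
Qed.

Lemma module_iso_trans (U V W : lmodType S) :
  module_iso U V -> module_iso V W -> module_iso U W.
Proof. by case=> f bf [g bg]; exists (g \o f); exact: bij_comp. Qed.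

Lemma module_iso_zero (U V : lmodType S) :
  module_iso U V -> zero_module U -> zero_module V.
Proof. by case=> f [g fK gK] U0 v; rewrite -[v]gK (U0 (g v)) raddf0. Qed.

Lemma module_iso_killed (U V : lmodType S) (a : S) : module_iso U V ->
  (forall u : U, a *: u = 0) -> forall v : V, a *: v = 0.
Proof. by case=> f [g fK gK] aU v; rewrite -[v]gK -linearZ aU raddf0. Qed.

Lemma module_iso_eq (I : Type) (V : I -> lmodType S) i j :
  i = j -> module_iso (V i) (V j).
Proof. by move=> ->; exact: module_iso_refl. Qed.

Lemma module_iso_prod (U U' V V' : lmodType S) :
  module_iso U U' -> module_iso V V' -> module_iso (U * V)%type (U' * V')%type.
Proof.
case=> f [f' fK f'K] [g [g' gK g'K]].
apply: (@module_iso_of_relation _ _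
  (fun (p : (U * V)%type) (q : (U' * V')%type) => f p.1 = q.1 /\ g p.2 = q.2)).
- by move=> a p p' q q' [e1 e2] [e3 e4]; rewrite !linearP /= e1 e2 e3 e4.
- by move=> p; exists (f p.1, g p.2).
- by move=> q; exists (f' q.1, g' q.2); rewrite /= f'K g'K.
- by move=> [q1 q2] /= []; rewrite !raddf0 => <- <-.
- move=> [p1 p2] /= [e1 e2]; congr pair.
    by rewrite -[p1]fK e1 -(raddf0 f) fK.
  by rewrite -[p2]gK e2 -(raddf0 g) gK.
Qed.

Lemma zero_module_prod (U V : lmodType S) :
  zero_module (U * V)%type <-> zero_module U /\ zero_module V.
Proof.
split=> [UV0|[U0 V0] [u v]]; last by rewrite (U0 u) (V0 v).
by split=> [u|v]; [exact: (congr1 fst (UV0 (u, 0))) | exact: (congr1 snd (UV0 (0, v)))].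
Qed.

End LinearRelations.

Section DirectSums.
Variable S : comPzRingType.

Lemma dsumP (I : Type) (V : I -> lmodType S) (f : dsum V) :
  finite_set [set i | dsum_val f i <> 0].
Proof. by have /asboolP := dsum_valP f. Qed.

Lemma dsum_ext (I : Type) (V : I -> lmodType S) (f g : dsum V) :
  (forall i, dsum_val f i = dsum_val g i) -> f = g.
Proof. by move=> fg; apply/val_inj/functional_extensionality_dep. Qed.

Lemma dsum_of (I : Type) (V : I -> lmodType S) (f : forall i, V i) :
  finite_set [set i | f i <> 0] -> exists g : dsum V, forall i, dsum_val g i = f i.
Proof. by move=> /asboolP ff; exists (@DSum _ _ _ f ff). Qed.

Lemma dsum0E (I : Type) (V : I -> lmodType S) i : dsum_val (0 : dsum V) i = 0.
Proof. by []. Qed.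

Lemma dsumDE (I : Type) (V : I -> lmodType S) (f g : dsum V) i :
  dsum_val (f + g) i = dsum_val f i + dsum_val g i.
Proof. by []. Qed.

Lemma dsumZDE (I : Type) (V : I -> lmodType S) a (f g : dsum V) i :
  dsum_val (a *: f + g) i = a *: dsum_val f i + dsum_val g i.
Proof. by []. Qed.

Lemma dsum_sumE (I : Type) (V : I -> lmodType S) (K : Type) (r : seq K) (P : pred K)
    (F : K -> dsum V) i :
  dsum_val (\sum_(k <- r | P k) F k) i = \sum_(k <- r | P k) dsum_val (F k) i.
Proof.
exact: (big_morph (fun f : dsum V => dsum_val f i) (fun f g => dsumDE f g i) (dsum0E V i)).
Qed.

Lemma module_iso_dsum (I : Type) (V W : I -> lmodType S) :
  (forall i, module_iso (V i) (W i)) -> module_iso (dsum V) (dsum W).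
Proof.
move=> VW.
have VW' i : exists fg : {linear V i -> W i} * (W i -> V i),
    cancel fg.1 fg.2 /\ cancel fg.2 fg.1.
  by case: (VW i) => f [g fK gK]; exists (f, g).
pose f i := (projT1 (cid (VW' i))).1; pose g i := (projT1 (cid (VW' i))).2.
have fK i : cancel (f i) (g i) by rewrite /f /g; case: cid => ? [].
have gK i : cancel (g i) (f i) by rewrite /f /g; case: cid => ? [].
have g0 i : g i 0 = 0 by rewrite -(raddf0 (f i)) fK.
apply: (@module_iso_of_relation _ _ _
  (fun (p : dsum V) (q : dsum W) => forall i, f i (dsum_val p i) = dsum_val q i)).
- by move=> a p p' q q' e e' i; rewrite !dsumZDE linearP e e'.
- move=> p; have [|q qE] := @dsum_of _ W (fun i => f i (dsum_val p i)); last first.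
    by exists q => i; rewrite qE.
  by apply: sub_finite_set (dsumP p) => i fp pi; apply: fp; rewrite pi raddf0.
- move=> q; have [|p pE] := @dsum_of _ V (fun i => g i (dsum_val q i)).
    by apply: sub_finite_set (dsumP q) => i gq qi; apply: gq; rewrite qi g0.
  by exists p => i; rewrite pE gK.
- by move=> q qE; apply: dsum_ext => i; rewrite -qE raddf0.
- by move=> p pE; apply: dsum_ext => i; rewrite -[dsum_val p i]fK pE g0.
Qed.

Lemma module_iso_dsum_prod (I : Type) (V W : I -> lmodType S) :
  module_iso (dsum (fun i => (V i * W i)%type : lmodType S)) (dsum V * dsum W)%type.
Proof.
apply: (@module_iso_of_relation _ _ _
  (fun (p : dsum (fun i => (V i * W i)%type : lmodType S)) (q : (dsum V * dsum W)%type) =>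
    forall i, dsum_val p i = (dsum_val q.1 i, dsum_val q.2 i))).
- by move=> a p p' q q' e e' i; rewrite dsumZDE e e'.
- move=> p.
  have [|q1 q1E] := @dsum_of _ V (fun i => (dsum_val p i).1).
    by apply: sub_finite_set (dsumP p) => i /= p1 pi; apply: p1; rewrite pi.
  have [|q2 q2E] := @dsum_of _ W (fun i => (dsum_val p i).2).
    by apply: sub_finite_set (dsumP p) => i /= p2 pi; apply: p2; rewrite pi.
  by exists (q1, q2) => i /=; rewrite q1E q2E; case: (dsum_val p i).
- move=> [q1 q2].
  have [|p pE] := @dsum_of _ (fun i => (V i * W i)%type) (fun i => (dsum_val q1 i, dsum_val q2 i)).
    apply: (@sub_finite_set _ _ ([set i | dsum_val q1 i <> 0]
      `|` [set i | dsum_val q2 i <> 0])%classic).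
      move=> i /= pi; have [q10|] := pselect (dsum_val q1 i = 0); last by left.
      by right=> q20; apply: pi; rewrite q10 q20.
    by rewrite finite_setU; split; exact: dsumP.
  by exists p.
- move=> [q1 q2] e; congr pair; apply: dsum_ext => i; by have [] := e i.
- by move=> p e; apply: dsum_ext => i; rewrite e.
Qed.

Lemma module_iso_dsum_shift (V : nat -> lmodType S) :
  zero_module (V 0%N) -> module_iso (dsum V) (dsum (fun k => V k.+1)).
Proof.
move=> V0; apply: (@module_iso_of_relation _ _ _
  (fun (p : dsum V) (q : dsum (fun k => V k.+1)) => forall k, dsum_val p k.+1 = dsum_val q k)).
- by move=> a p p' q q' e e' i; rewrite !dsumZDE e e'.
- move=> p; have [|q qE] := @dsum_of _ (fun k => V k.+1) (fun k => dsum_val p k.+1).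
    have := finite_image predn (dsumP p); apply: sub_finite_set => k /= pk.
    by exists k.+1.
  by exists q.
- move=> q.
  have [|p pE] := @dsum_of _ V (fun k => if k is j.+1 then dsum_val q j else 0).
    have := finite_image succn (dsumP q); apply: sub_finite_set => -[|k] //= qk.
    by exists k.
  by exists p => k; rewrite pE.
- by move=> q e; apply: dsum_ext => i; rewrite -e.
- by move=> p e; apply: dsum_ext => -[|k]; [exact: V0 | rewrite e].
Qed.

Lemma module_iso_ffun (I : finType) (V W : lmodType S) :
  module_iso V W -> module_iso {ffun I -> V} {ffun I -> W}.
Proof.
case=> f [g fK gK]; apply: (@module_iso_of_relation _ _ _
  (fun (p : {ffun I -> V}) (q : {ffun I -> W}) => forall i, f (p i) = q i)).
- by move=> a p p' q q' e e' i; rewrite !ffunE linearP e e'.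
- by move=> p; exists [ffun i => f (p i)] => i; rewrite ffunE.
- by move=> q; exists [ffun i => g (q i)] => i; rewrite ffunE gK.
- by move=> q e; apply/ffunP => i; rewrite -e !ffunE raddf0.
- by move=> p e; apply/ffunP => i; rewrite -[p i]fK e !ffunE -(raddf0 f) fK.
Qed.

Lemma module_iso_ffun_add (V : lmodType S) (a b : nat) :
  module_iso {ffun 'I_(a + b) -> V} ({ffun 'I_a -> V} * {ffun 'I_b -> V})%type.
Proof.
apply: (@module_iso_of_relation _ _ _
  (fun (p : {ffun 'I_(a + b) -> V}) (q : ({ffun 'I_a -> V} * {ffun 'I_b -> V})%type) =>
    (forall i, p (lshift b i) = q.1 i) /\ (forall i, p (rshift a i) = q.2 i))).
- move=> c p p' q q' [e1 e2] [e1' e2'].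
  by split=> i; rewrite !ffunE ?e1 ?e1' ?e2 ?e2'.
- move=> p; exists ([ffun i => p (lshift b i)], [ffun i => p (rshift a i)]).
  by split=> i; rewrite ffunE.
- move=> [q1 q2].
  exists [ffun i => match fintype.split i with inl j => q1 j | inr j => q2 j end].
  split=> i; rewrite ffunE.
    by rewrite -[lshift b i]/(unsplit (inl i)) unsplitK.
  by rewrite -[rshift a i]/(unsplit (inr i)) unsplitK.
- by move=> [q1 q2] /= [e1 e2]; congr pair; apply/ffunP => i; rewrite -(e1, e2) !ffunE.
- move=> p [e1 e2]; apply/ffunP => i; rewrite -[i]splitK.
  by case: (fintype.split i) => j /=; rewrite (e1, e2) !ffunE.
Qed.

Lemma zero_module_ffun (V : lmodType S) (I : finType) :
  #|I| = 0%N -> zero_module {ffun I -> V}.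
Proof. by move=> /eqP/pred0P I0 f; apply/ffunP => i; have := I0 i. Qed.

End DirectSums.

(** * Homology through representatives *)

Section QuotientLift.
Variables (S : comPzRingType) (U V : lmodType S) (B : submodClosed U).

Lemma quot_surj (q : quot_module B) : exists u, \pi_(quot_module B) u = q.
Proof. by exists (repr q); rewrite reprK. Qed.

Lemma quot_eq0 u : \pi_(quot_module B) u = 0 <-> u \in B.
Proof.
by rewrite -[0](raddf0 \pi_(quot_module B)) quot_module_eq subr0.
Qed.

Lemma quot_pi_linear : linear (\pi_(quot_module B) : U -> quot_module B).
Proof. by move=> a u v; rewrite raddfD; congr (_ + _); exact/esym/quot_moduleZ. Qed.

Definition quot_pi : {linear U -> quot_module B} := mk_linear quot_pi_linear.

Lemma quot_lift_subproof (f : {linear U -> V}) : (forall u, u \in B -> f u = 0) ->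
  exists g : {linear quot_module B -> V}, forall u, g (quot_pi u) = f u.
Proof.
move=> fB.
have [||v [u [/quot_eq0 /fB <-]]|g gE] //:= @linear_of_relation _ (quot_module B) V
  (fun q v => exists u, quot_pi u = q /\ f u = v).
- by move=> a _ _ _ _ [u [<- <-]] [v [<- <-]]; exists (a *: u + v); rewrite !linearP.
- by move=> q; have [u <-] := quot_surj q; exists (f u), u.
by exists g => u; apply/esym/gE; exists u.
Qed.

Definition quot_lift (f : {linear U -> V}) (fB : forall u, u \in B -> f u = 0) :
  {linear quot_module B -> V} := projT1 (cid (quot_lift_subproof fB)).

Lemma quot_liftE f fB u : @quot_lift f fB (quot_pi u) = f u.
Proof. by rewrite /quot_lift; case: cid. Qed.

End QuotientLift.
Arguments quot_pi {S U} B.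

Section HomologyClasses.
Variable S : comPzRingType.
Implicit Types (C : complex S) (n : int).

(** Quantifying over all target and source degrees costs nothing, since the
    differential vanishes off consecutive degrees, and it makes both notions
    insensitive to the shape of the expression that denotes the degree. *)
Definition is_cycle C n (z : C n) : Prop := forall j, cdiff C n j z = 0.
Definition is_boundary C n (z : C n) : Prop := exists j y, cdiff C j n y = z.

Lemma cycle_predP C n (z : C n) : z \in cycle_pred C n <-> is_cycle z.
Proof.
split=> [/eqP dz j|dz]; last by apply/eqP; exact: dz.
have [nj|nj] := eqVneq n (j + 1); last exact: cdiff_deg.
by have -> : j = n - 1 by rewrite nj addrK.
Qed.

Lemma boundary_predP C n (z : cycles C n) :
  z \in boundary_pred C n <-> is_boundary (cycle_val z).
Proof.
split=> [/asboolP[y dy]|[j [y dy]]]; first by exists (n + 1), y.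
apply/asboolP; have [jn|jn] := eqVneq j (n + 1); first by subst j; exists y.
by exists 0; rewrite raddf0 -dy cdiff_deg.
Qed.

Lemma boundary_cycle C n (z : C n) : is_boundary z -> is_cycle z.
Proof. by case=> j [y <-] k; rewrite cdiff_sq. Qed.

Lemma cycle0 C n : is_cycle (0 : C n).
Proof. by move=> j; rewrite raddf0. Qed.

Lemma cycleD C n (z w : C n) : is_cycle z -> is_cycle w -> is_cycle (z + w).
Proof. by move=> dz dw j; rewrite raddfD /= dz dw addr0. Qed.

Lemma cycleN C n (z : C n) : is_cycle z -> is_cycle (- z).
Proof. by move=> dz j; rewrite raddfN /= dz oppr0. Qed.

Lemma cycleB C n (z w : C n) : is_cycle z -> is_cycle w -> is_cycle (z - w).
Proof. by move=> dz dw; exact/cycleD/cycleN. Qed.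

Lemma boundary0 C n : is_boundary (0 : C n).
Proof. by exists n, 0; rewrite raddf0. Qed.

Lemma boundaryE C n m (z : C n) :
  m = n + 1 -> is_boundary z -> exists y : C m, cdiff C m n y = z.
Proof.
move=> -> [j [y dy]]; have [jn|jn] := eqVneq j (n + 1); first by subst j; exists y.
by exists 0; rewrite raddf0 -dy cdiff_deg.
Qed.

Lemma cycleE C n (z : C n) : cdiff C n (n - 1) z = 0 -> is_cycle z.
Proof. by move=> dz; apply/cycle_predP/eqP. Qed.

Lemma boundaryP C n a (z w : C n) : is_boundary z -> is_boundary w -> is_boundary (a *: z + w).
Proof.
move=> /(boundaryE erefl)[y dy] /(boundaryE erefl)[x dx].
by exists (n + 1), (a *: y + x); rewrite linearP dy dx.
Qed.

Lemma boundaryD C n (z w : C n) : is_boundary z -> is_boundary w -> is_boundary (z + w).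
Proof. by move=> bz bw; rewrite -[z]scale1r; exact: boundaryP. Qed.

(** Maps between homology modules are constructed from relations between classes
    that are read off from representatives. *)
Definition represents C n (z : C n) (h : homology C n) : Prop :=
  exists2 c : cycles C n, cycle_val c = z & homology_class c = h.

Lemma homology_class_linear C n :
  linear (@homology_class S C n : cycles C n -> homology C n).
Proof. exact: quot_pi_linear. Qed.

Lemma represents_linear C n : linear_relation (@represents C n).
Proof.
move=> a _ _ _ _ [c <- <-] [c' <- <-]; exists (a *: c + c') => //.
by rewrite homology_class_linear.
Qed.

Lemma represents_cycle C n (z : C n) h : represents z h -> is_cycle z.
Proof. by case=> c <- _; exact/cycle_predP/cycleP. Qed.

Lemma cycle_represents C n (z : C n) : is_cycle z -> exists h, represents z h.
Proof. by move=> /cycle_predP dz; exists (homology_class (Cycle dz)), (Cycle dz). Qed.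

Lemma represents_surj C n (h : homology C n) : exists z, represents z h.
Proof. by have [c ch] := quot_surj h; exists (cycle_val c), c. Qed.

Lemma represents0 C n (z : C n) : is_boundary z -> represents z 0.
Proof.
move=> bz; have /cycle_predP dz := boundary_cycle bz.
by exists (Cycle dz) => //; apply/quot_eq0/boundary_predP.
Qed.

Lemma represents0_boundary C n (z : C n) : represents z 0 -> is_boundary z.
Proof. by case=> c <- /quot_eq0/boundary_predP. Qed.

Lemma representsB C n (z w : C n) g h :
  represents z g -> represents w h -> represents (z - w) (g - h).
Proof.
move=> zg wh; rewrite addrC [g - h]addrC -!scaleN1r; exact: represents_linear.
Qed.

Lemma represents_eq C n (z w : C n) g h :
  represents z g -> represents w h -> is_boundary (z - w) <-> g = h.
Proof.
move=> zg wh; have zwgh := representsB zg wh; split=> [bzw|gh].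
  apply: subr0_eq; have [c cz <-] := zwgh.
  by apply/quot_eq0/boundary_predP; rewrite cz.
by apply: represents0_boundary; rewrite -[0](subrr g) {2}gh.
Qed.

Lemma represents_scale C n (z : C n) h a : represents z h -> represents (a *: z) (a *: h).
Proof.
move=> zh; rewrite -[a *: z]addr0 -[a *: h]addr0; apply: represents_linear => //.
exact/represents0/boundary0.
Qed.

Lemma zero_homology C n :
  zero_module (homology C n) <-> forall z : C n, is_cycle z -> is_boundary z.
Proof.
split=> [H0 z /cycle_represents[h zh]|cb h].
  by apply: represents0_boundary; rewrite -(H0 h).
have [z zh] := represents_surj h.
have bz := cb z (represents_cycle zh).
by apply/(represents_eq zh (represents0 (boundary0 C n))); rewrite subr0.
Qed.

Lemma homology_zero C n : zero_module (C n) -> zero_module (homology C n).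
Proof. by move=> C0; apply/zero_homology => z _; rewrite (C0 z); exact: boundary0. Qed.

Lemma homology_iso_of_map C C' n n' (f : {linear C n -> C' n'}) :
  (forall z, is_cycle z -> is_cycle (f z)) ->
  (forall z, is_cycle z -> is_boundary (f z) <-> is_boundary z) ->
  (forall w, is_cycle w -> exists2 z, is_cycle z & is_boundary (f z - w)) ->
  module_iso (homology C n) (homology C' n').
Proof.
move=> fc fb fs; apply: (@module_iso_of_relation _ _ _
  (fun h h' => exists z, represents z h /\ represents (f z) h')).
- move=> a h h' k k' [z [zh zk]] [z' [zh' zk']]; exists (a *: z + z').
  by rewrite linearP; split; exact: represents_linear.
- move=> h; have [z zh] := represents_surj h.
  by have [k zk] := cycle_represents (fc _ (represents_cycle zh)); exists k, z.
- move=> k; have [w wk] := represents_surj k.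
  have [z dz bz] := fs w (represents_cycle wk).
  have [h zh] := cycle_represents dz; exists h, z; split=> //.
  have [k' zk'] := cycle_represents (fc _ dz).
  by have /(represents_eq zk' wk) <- := bz.
- move=> k [z [zh zk]]; apply/(represents_eq zk (represents0 (boundary0 _ _))).
  by rewrite subr0; apply/fb; [exact: represents_cycle zh | exact: represents0_boundary].
- move=> h [z [zh zk]]; apply/(represents_eq zh (represents0 (boundary0 _ _))).
  by rewrite subr0; apply/fb; [exact: represents_cycle zh | exact: represents0_boundary].
Qed.

Lemma complex_iso_homology C C' (f : chain_map C C') n :
  (forall m z, f m z = 0 -> z = 0) -> surjective_map f ->
  module_iso (homology C n) (homology C' n).
Proof.
move=> f0 fs; apply: (@homology_iso_of_map _ _ _ _ (f n)).
- by move=> z dz j; rewrite -cmap_diff dz raddf0.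
- move=> z dz; split=> [[j [y dy]]|[j [y <-]]].
    have [x xy] := fs _ y; exists j, x; apply/subr0_eq/(f0 n).
    by rewrite raddfB /= cmap_diff xy dy subrr.
  by exists j, (f j y); rewrite cmap_diff.
- move=> w dw; have [z zw] := fs _ w; exists z; last first.
    by rewrite zw subrr; exact: boundary0.
  by move=> j; apply: (f0 j); rewrite cmap_diff zw dw.
Qed.

(** The differential of the shift is that of [C] up to a sign, which is a unit:
    cycles and boundaries are the same. *)
Lemma homology_cshift C (i : int) n :
  module_iso (homology (cshift i C) n) (homology C (n - i)).
Proof.
have s0 m (v : C m) : (-1) ^+ `|i|%N *: v = 0 :> C m -> v = 0.
  by move=> /(congr1 ( *:%R ((-1) ^+ `|i|%N))); rewrite scaler0 signrZK.
have cE z : is_cycle (z : cshift i C n) <-> is_cycle (z : C (n - i)).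
  split=> dz j; last by rewrite /= dz scaler0.
  by have := dz (j + i); rewrite /= addrK => /s0.
have bE z : is_boundary (z : cshift i C n) <-> is_boundary (z : C (n - i)).
  split=> [[j [y /= <-]]|[j [y <-]]].
    by exists (j - i), ((-1) ^+ `|i|%N *: y); rewrite linearZ.
  rewrite -[j](addrK i) in y *.
  by exists (j + i), ((-1) ^+ `|i|%N *: y : C (j + i - i)); rewrite /= linearZ signrZK.
apply: (@homology_iso_of_map (cshift i C) C n (n - i) idfun).
- by move=> z /cE.
- by move=> z _; exact: iff_sym (bE z).
- by move=> w /cE dw; exists w => //; rewrite subrr; exact: boundary0.
Qed.

Lemma homology_cpower C (a : nat) n :
  module_iso (homology (cpower C a) n) {ffun 'I_a -> homology C n}.
Proof.
have cE (z : cpower C a n) : is_cycle z <-> forall k, is_cycle (z k).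
  split=> [dz k j|dz j]; last by apply/ffunP => k; rewrite !ffunE; exact: dz.
  by have /ffunP/(_ k) := dz j; rewrite !ffunE.
have bE (z : cpower C a n) : is_boundary z <-> forall k, is_boundary (z k).
  split=> [[j [y <-]] k|bz]; first by exists j, (y k); rewrite !ffunE.
  have [y yz] := @choice _ _ (fun k y => cdiff C (n + 1) n y = z k)
    (fun k => boundaryE erefl (bz k)).
  by exists (n + 1), [ffun k => y k]; apply/ffunP => k; rewrite !ffunE yz.
apply: (@module_iso_of_relation _ _ _ (fun h (h' : {ffun 'I_a -> homology C n}) =>
  exists z : cpower C a n, represents z h /\ forall k, represents (z k) (h' k))).
- move=> b h h' k k' [z [zh zk]] [z' [zh' zk']]; exists (b *: z + z').
  split=> [|l]; first exact: represents_linear.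
  by rewrite !ffunE; exact: represents_linear.
- move=> h; have [z zh] := represents_surj h.
  have /cE zc := represents_cycle zh.
  have [h' zh'] := @choice _ _ (fun k => @represents C n (z k)) (fun k => cycle_represents (zc k)).
  by exists [ffun k => h' k], z; split=> // k; rewrite ffunE.
- move=> h'.
  have [z zh'] := @choice _ _ (fun k (z : C n) => represents z (h' k))
    (fun k => represents_surj (h' k)).
  have /cE/cycle_represents[h zh] :
      forall k, is_cycle (([ffun k => z k] : cpower C a n) k).
    by move=> k; rewrite ffunE; exact: represents_cycle (zh' k).
  by exists h, [ffun k => z k]; split=> // k; rewrite ffunE.
- move=> h' [z [/represents0_boundary/bE zb zh]]; apply/ffunP => k; rewrite [RHS]ffunE.
  by apply/(represents_eq (zh k) (represents0 (boundary0 _ _))); rewrite subr0.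
- move=> h [z [zh zh']]; apply/(represents_eq zh (represents0 (boundary0 _ _))).
  rewrite subr0; apply/bE => k; apply: represents0_boundary.
  by have := zh' k; rewrite ffunE.
Qed.

(** Stated without homology modules, the notion no longer depends on the ring
    over which the complexes are considered. *)
Lemma quasi_isoP C C' (f : chain_map C C') :
  quasi_iso f <->
  (forall n (z : C n), is_cycle z -> is_boundary (f n z) -> is_boundary z) /\
  (forall n (w : C' n), is_cycle w -> exists2 z, is_cycle z & is_boundary (f n z - w)).
Proof.
have mapE n (z : C n) h : represents z h -> represents (f n z) (homology_map f h).
  by case=> c <- <-; rewrite homology_mapE; exists (cycle_map f c).
split=> [qf|[fi fs] n].
  split=> n => [z dz bz|w dw].
    have [h zh] := cycle_represents dz.
    have [g gK _] := qf n.
    have h0 : homology_map f h = 0.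
      apply/(represents_eq (mapE _ _ _ zh) (represents0 (boundary0 _ _))).
      by rewrite subr0.
    have f0 : homology_map f (0 : homology C n) = 0.
      have := mapE _ _ _ (represents0 (boundary0 C n)).
      rewrite raddf0 => /represents_eq /(_ (represents0 (boundary0 C' n))) [<- //].
      by rewrite subrr; exact: boundary0.
    by apply: represents0_boundary; rewrite -[0]gK f0 -h0 gK.
  have [h' wh'] := cycle_represents dw; have [g _ gK] := qf n.
  have [z zh] := represents_surj (g h'); exists z; first exact: represents_cycle zh.
  by apply/(represents_eq (mapE _ _ _ zh) wh'); rewrite gK.
apply: injective_surjective_bijective.
  move=> h h' hh'; have [z zh] := represents_surj h; have [z' zh'] := represents_surj h'.
  apply/(represents_eq zh zh')/fi.
    by apply: cycleB; [exact: represents_cycle zh | exact: represents_cycle zh'].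
  by rewrite raddfB /=; apply/(represents_eq (mapE _ _ _ zh) (mapE _ _ _ zh')).
move=> h'; have [w wh'] := represents_surj h'.
have [z dz bz] := fs _ w (represents_cycle wh').
have [h zh] := cycle_represents dz; exists h.
exact/(represents_eq (mapE _ _ _ zh) wh').
Qed.

End HomologyClasses.

Section Restrict.
Variables (R S : comPzRingType) (f : {rmorphism R -> S}).

Lemma homology_restrict (C : complex S) n :
  module_iso (restr f (homology C n)) (homology (restrict f C) n).
Proof.
apply: (@module_iso_of_relation R (restr f (homology C n)) (homology (restrict f C) n)
  (fun h h' => exists z : C n, represents z h /\ represents (C := restrict f C) z h')).
- move=> a h h' k k' [z [zh zk]] [z' [zh' zk']]; exists (f a *: z + z').
  by split; [exact: represents_linear | exact: (represents_linear (C := restrict f C))].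
- move=> h; have [z zh] := represents_surj (h : homology C n).
  have [k zk] := @cycle_represents R (restrict f C) n z (represents_cycle zh).
  by exists k, z.
- move=> k; have [z zk] := represents_surj k.
  have [h zh] := @cycle_represents S C n z (represents_cycle zk).
  by exists h, z.
- move=> k [z [/represents0_boundary zb zk]].
  apply/(represents_eq zk (represents0 (boundary0 _ _))).
  by rewrite subr0.
- move=> h [z [zh /represents0_boundary zb]].
  apply/(represents_eq zh (represents0 (boundary0 _ _))).
  by rewrite subr0.
Qed.

Lemma module_iso_restr (U V : lmodType S) :
  module_iso U V -> module_iso (restr f U) (restr f V).
Proof. by case=> g bg; exists (restr_fun (f:=f) g : {linear restr f U -> restr f V}). Qed.

(** For modules over a quotient ring, linearity over the ring and over the
    quotient are the same. *)
Lemma module_iso_descend (U V : lmodType S) : (forall s, exists r, f r = s) ->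
  module_iso (restr f U) (restr f V) -> module_iso U V.
Proof.
move=> fs [g bg].
have g_lin : linear (g : U -> V).
  by move=> s u v; have [r <-] := fs s; exact: (linearP g r u v).
by exists (mk_linear g_lin).
Qed.

Lemma module_iso_restr_dsum (I : Type) (V : I -> lmodType S) :
  module_iso (restr f (dsum V)) (dsum (fun i => restr f (V i) : lmodType R)).
Proof.
apply: (@module_iso_of_relation R (restr f (dsum V)) (dsum (fun i => restr f (V i) : lmodType R))
  (fun p q => forall i, dsum_val (p : dsum V) i = dsum_val q i)).
- by move=> a p p' q q' e e' i; rewrite [RHS]dsumZDE -e -e'.
- move=> p; have [|q qE] := @dsum_of R I (fun i => restr f (V i)) (dsum_val (p : dsum V)).
    exact: (@dsumP S I V p).
  by exists q => i; rewrite qE.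
- move=> q; have [|p pE] := @dsum_of S I V (dsum_val q).
    exact: (dsumP q).
  by exists p => i; rewrite pE.
- by move=> q e; apply: dsum_ext => i; rewrite -e.
- by move=> p e; apply: (@dsum_ext S I V) => i; rewrite e.
Qed.

Lemma module_iso_restr_ffun (I : finType) (V : lmodType S) :
  module_iso (restr f {ffun I -> V}) {ffun I -> restr f V}.
Proof.
apply: (@module_iso_of_relation R (restr f {ffun I -> V}) {ffun I -> restr f V}
  (fun p q => forall i, (p : {ffun I -> V}) i = q i)).
- by move=> a p p' q q' e e' i; rewrite !ffunE -e -e'.
- by move=> p; exists [ffun i => (p : {ffun I -> V}) i] => i; rewrite ffunE.
- by move=> q; exists [ffun i => (q i : V)] => i; rewrite ffunE.
- move=> q e; apply/ffunP => i; rewrite -e [RHS]ffunE.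
  exact: (ffunE (fun=> 0 : V) i).
- move=> p e; apply/(@ffunP I (fun=> V)) => i; rewrite e [LHS]ffunE.
  exact/esym/(ffunE (fun=> 0 : V) i).
Qed.

End Restrict.

(** * Semi-projective complexes and regular sequences *)

Definition regular_module (S : comPzRingType) : lmodType S := S^o.

Section FreeModules.
Variables (S : comPzRingType) (U : lmodType S).

Definition free_module : lmodType S := dsum (fun _ : U => regular_module S).

Definition free_eval (f : free_module) : U :=
  \sum_(i \in [set: U]) (dsum_val f i : S) *: i.

Lemma free_eval_linear : linear free_eval.
Proof.
move=> a f g.
pose A := fset_set ([set i | dsum_val f i <> 0] `|` [set i | dsum_val g i <> 0])%classic.
have A0 i : i \notin A -> dsum_val f i = 0 /\ dsum_val g i = 0.
  rewrite in_fset_set; last by rewrite finite_setU; split; exact: dsumP.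
  by move=> /negP iA; split; apply: contrapT => i0; apply: iA; rewrite inE /=; [left|right].
have AE h : (forall i, i \notin A -> dsum_val h i = 0) ->
    free_eval h = \sum_(i <- A) (dsum_val h i : S) *: i.
  by move=> h0; rewrite /free_eval (fsbigTE A) // => i /h0->; rewrite scale0r.
rewrite (AE f) => [|i /A0[]//]; rewrite (AE g) => [|i /A0[]//].
rewrite AE => [|i /A0[f0 g0]]; last first.
  by rewrite -[LHS]/(a * dsum_val f i + dsum_val g i) f0 g0 mulr0 addr0.
rewrite scaler_sumr -big_split /=; apply: eq_bigr => i _.
by rewrite -[LHS]/((a * dsum_val f i + dsum_val g i) *: i) scalerDl scalerA.
Qed.

Lemma free_eval_surj u : exists f, free_eval f = u.
Proof.
have [|f fE] := @dsum_of S U (fun=> regular_module S) (fun i => if i == u then 1 else 0).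
  apply: (sub_finite_set (B := [set u])) => // i /=.
  by have [->|] := eqVneq i u.
exists f; rewrite /free_eval (fsbigTE [fset u]%fset) => [|i].
  by rewrite big_seq_fset1 fE eqxx scale1r.
by rewrite inE => /negbTE iu; rewrite fE iu scale0r.
Qed.

End FreeModules.

Section SemiProjective.
Variables (S : comPzRingType).

Section Contractible.
Variable U : lmodType S.

Definition cone_diff (i j : int) (u : U * U) : U * U :=
  if i == j + 1 then (u.2, 0) else 0.

Lemma cone_diff_linear i j : linear (cone_diff i j).
Proof.
move=> a u v; rewrite /cone_diff; case: eqP => _; last by rewrite scaler0 addr0.
by congr pair; rewrite /= scaler0 addr0.
Qed.

Lemma cone_diff_deg i j u : i != j + 1 -> mk_linear (cone_diff_linear i j) u = 0.
Proof. by rewrite /= /cone_diff => /negbTE->. Qed.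

Lemma cone_diff_sq i j k u :
  mk_linear (cone_diff_linear j k) (mk_linear (cone_diff_linear i j) u) = 0.
Proof. by rewrite /= /cone_diff; case: eqP => //; case: eqP. Qed.

(** The sum over all degrees of the cones of the identity of [U]: using the
    same object in each degree keeps it contractible and avoids casts. *)
Definition contractible : complex S :=
  @Complex S (fun=> (U * U)%type) (fun i j => mk_linear (cone_diff_linear i j))
    cone_diff_deg cone_diff_sq.

Lemma contractible_boundary n (z : contractible n) : is_cycle z -> is_boundary z.
Proof.
move=> /(_ (n - 1)); rewrite /= /cone_diff subrK eqxx => -[z2].
exists (n + 1), (0, z.1); rewrite /= /cone_diff eqxx /=.
by case: z z2 => z1 z2 /= ->.
Qed.

End Contractible.

Lemma contractible_map_subproof (U V : lmodType S) (g : {linear U -> V}) :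
  linear (fun u : U * U => (g u.1, g u.2)).
Proof. by move=> a u v; rewrite !linearP. Qed.

Lemma contractible_map_diff (U V : lmodType S) (g : {linear U -> V}) i j
    (u : contractible U i) :
  mk_linear (contractible_map_subproof g) (cdiff (contractible U) i j u) =
  cdiff (contractible V) i j (mk_linear (contractible_map_subproof g) u).
Proof. by rewrite /= /cone_diff; case: eqP => _ /=; rewrite !raddf0. Qed.

Definition contractible_map (U V : lmodType S) (g : {linear U -> V}) :
    chain_map (contractible U) (contractible V) :=
  @ChainMap S (contractible U) (contractible V)
    (fun=> mk_linear (contractible_map_subproof g)) (@contractible_map_diff U V g).

Lemma contractible_map_qis (U V : lmodType S) (g : {linear U -> V}) :
  quasi_iso (contractible_map g).
Proof.
apply/quasi_isoP; split=> n z dz; first by move=> _; exact: contractible_boundary.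
exists 0; first exact: cycle0.
by rewrite raddf0 sub0r; exact/contractible_boundary/cycleN.
Qed.

Lemma mk_hom (P X : complex S) n (f : forall p q, P p -> X q) :
  (forall p q, linear (f p q)) -> (forall p q x, q != p + n -> f p q x = 0) ->
  exists h : hom P X n, forall p q x, h p q x = f p q x.
Proof.
move=> f_lin f_deg.
have /asboolP fP : (forall p q, linear (f p q)) /\ (forall p q x, q != p + n -> f p q x = 0).
  by [].
by exists (@Hom S P X n (f : hom_family P X) fP).
Qed.

Lemma degree_component (P : complex S) n : exists f : forall p, P p -> P n,
  [/\ forall p, linear (f p), forall x, f n x = x & forall p x, p != n -> f p x = 0].
Proof.
exists (fun p x => if @eqP _ p n is ReflectT e then eq_rect p (fun m => P m : Type) x n e else 0).
split=> [p|x|p x].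
- by case: eqP => [e|_] a x y; [case: _ / e | rewrite scaler0 addr0].
- by case: eqP => // e; rewrite (eq_irrelevance e erefl).
- by case: eqP.
Qed.

(** The modules of a semi-projective complex are projective: lifting the
    identity of [P n] along a map of contractible complexes, which is always a
    quasi-isomorphism, is the same as splitting a surjection onto [P n]. *)
Lemma semi_projective_section (P : complex S) n (U : lmodType S) (g : {linear U -> P n}) :
  semi_projective P -> (forall v, exists u, g u = v) ->
  exists s : {linear P n -> U}, forall v, g (s v) = v.
Proof.
move=> Psemi gs.
have [f [f_lin fn f0]] := degree_component P n.
have bs : surjective_map (contractible_map g).
  by move=> m [v1 v2]; have [[u1 <-] [u2 <-]] := (gs v1, gs v2); exists (u1, u2).
have [+ _] := Psemi _ _ _ bs (contractible_map_qis g).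
have [||h hE] := @mk_hom P (contractible (P n)) (- n)
  (fun p q x => if q == 0 then (f p x, 0) else 0).
- move=> p q a x y; case: eqP => _; last by rewrite scaler0 addr0.
  by congr pair; rewrite ?f_lin //= scaler0 addr0.
- move=> p q x qp; case: eqP => // q0; rewrite f0 //.
  by apply: contra_neq qp => ->; rewrite q0 subrr.
move=> /(_ (- n) h)[k kh].
have kE x : g (k n 0 x).1 = x.
  by have := hE n 0 x; rewrite -kh eqxx fn => /(congr1 fst).
have s_lin : linear (fun x => (k n 0 x).1) by move=> a x y; rewrite hom_linear.
by exists (mk_linear s_lin).
Qed.

End SemiProjective.

Section RegularQuotients.
Variables (R : comNzRingType) (d : nat) (x : d.-tuple R).

Section Submodule.
Variables (U : lmodType R) (k : nat).

(** [(x_0, ..., x_(k-1)) U]. *)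
Definition seq_submod : {pred U} := fun u =>
  `[< exists c : 'I_d -> U, u = \sum_(i < d | (i < k)%N) tnth x i *: c i >].

Lemma seq_submod_closed : submod_closed seq_submod.
Proof.
split.
  by apply/asboolP; exists (fun=> 0); rewrite big1 // => i _; rewrite scaler0.
move=> a u v /asboolP[b ->] /asboolP[c ->]; apply/asboolP.
exists (fun i => a *: b i + c i); rewrite scaler_sumr -big_split /=.
by apply: eq_bigr => i _; rewrite scalerDr !scalerA mulrC.
Qed.

HB.instance Definition _ :=
  GRing.isSubmodClosed.Build R U seq_submod seq_submod_closed.

End Submodule.
Arguments seq_submod : clear implicits.

Lemma seq_submod_map (U V : lmodType R) (f : {linear U -> V}) k u :
  u \in seq_submod U k -> f u \in seq_submod V k.
Proof.
move=> /asboolP[c ->]; apply/asboolP; exists (fun i => f (c i)).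
by rewrite raddf_sum; apply: eq_bigr => i _; exact: linearZ_LR.
Qed.

Lemma seq_submod0 (U : lmodType R) u : u \in seq_submod U 0 -> u = 0.
Proof. by move=> /asboolP[c ->]; rewrite big1. Qed.

Lemma seq_submodS (U : lmodType R) (i : 'I_d) u : u \in seq_submod U i.+1 <->
  exists v, u - tnth x i *: v \in seq_submod U i.
Proof.
split=> [/asboolP[c ->]|[v /asboolP[c uv]]].
  exists (c i); apply/asboolP; exists c.
  rewrite (bigD1 i) //= addrAC subrr add0r; apply: eq_bigl => j.
  by rewrite ltnS [RHS]ltn_neqAle andbC.
apply/asboolP; exists (fun j => if j == i then v else c j).
rewrite (bigD1 i) //= eqxx -[LHS](subrK (tnth x i *: v)) uv addrC; congr (_ + _).
apply: eq_big => [j|j jk].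
  by rewrite ltnS [LHS]ltn_neqAle andbC.
by rewrite -val_eqE (ltn_eqF jk).
Qed.

(** [x] is a weakly [U]-regular sequence. *)
Definition regular_on (U : lmodType R) : Prop := forall (i : 'I_d) (u : U),
  tnth x i *: u \in seq_submod U i -> u \in seq_submod U i.

Lemma regular_on_retract (U F : lmodType R) (s : {linear U -> F}) (g : {linear F -> U}) :
  (forall u, g (s u) = u) -> regular_on F -> regular_on U.
Proof.
have sZ a u : s (a *: u) = a *: s u by exact: linearZ_LR.
move=> sK Freg i u /(seq_submod_map s); rewrite sZ => /Freg.
by move=> /(seq_submod_map g); rewrite sK.
Qed.

(** Regularity is checked in each coordinate. The coefficients [b] are chosen to
    vanish where [u] does, so that the resulting families have finite support. *)
Lemma regular_on_free (I : Type) : regular_sequence x ->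
  regular_on (dsum (fun _ : I => regular_module R)).
Proof.
move=> [xreg _] i u /asboolP[c ucE].
have ui j : exists b : 'I_d -> R, dsum_val u j = \sum_(l < d | (l < i)%N) tnth x l * b l /\
    (dsum_val u j = 0 -> forall l, b l = 0).
  have [u0|u0] := pselect (dsum_val u j = 0).
    by exists (fun=> 0); split=> //; rewrite u0 big1 // => l _; rewrite mulr0.
  have /xreg/asboolP[b bE] : tnth x i * dsum_val u j \in seq_ideal x i.
    apply/asboolP; exists (fun l => dsum_val (c l) j).
    have := congr1 (fun v => dsum_val v j) ucE.
    rewrite -[dsum_val (tnth x i *: u) j]/(tnth x i * dsum_val u j) => ->.
    by rewrite dsum_sumE; apply: eq_bigr => l _; rewrite mulrC.
  by exists b; split=> [|//]; rewrite bE; apply: eq_bigr => l _; rewrite mulrC.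
have [b bP] := @choice _ _ _ ui.
have bE l : exists v : dsum (fun _ : I => regular_module R), forall j, dsum_val v j = b j l.
  apply: dsum_of; apply: sub_finite_set (dsumP u) => j /= bj uj; apply: bj.
  by have [_ ->] := bP j.
have [v vE] := @choice _ _ _ bE.
apply/asboolP; exists v; apply: dsum_ext => j.
have [-> _] := bP j.
by rewrite dsum_sumE; apply: eq_bigr => l _; rewrite -vE.
Qed.

Lemma semi_projective_regular (P : complex R) n :
  regular_sequence x -> semi_projective P -> regular_on (P n).
Proof.
move=> xreg Psemi.
have [s sK] := semi_projective_section (g := mk_linear (@free_eval_linear _ (P n)))
  Psemi (@free_eval_surj _ (P n)).
apply: (regular_on_retract sK); exact: regular_on_free xreg.
Qed.

End RegularQuotients.
Arguments seq_submod {R d} x U k _ : rename.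

(** * Reduction modulo a regular element *)

Section QuotientComplex.
Variables (S : comPzRingType) (P : complex S) (B : forall n, submodClosed (P n)).
Hypothesis B_diff : forall i j u, u \in B i -> cdiff P i j u \in B j.

Lemma quot_complex_diff_subproof i j u :
  u \in B i -> (quot_pi (B j) \o cdiff P i j : {linear _ -> _}) u = 0.
Proof. by move=> /(@B_diff i j) uB; apply/quot_eq0. Qed.

Definition quot_complex_diff i j : {linear quot_module (B i) -> quot_module (B j)} :=
  quot_lift (@quot_complex_diff_subproof i j).

Lemma quot_complex_diffE i j u :
  quot_complex_diff i j (quot_pi (B i) u) = quot_pi (B j) (cdiff P i j u).
Proof. by rewrite /quot_complex_diff quot_liftE. Qed.

Lemma quot_complex_diff_deg i j u : i != j + 1 -> quot_complex_diff i j u = 0.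
Proof.
by have [v <-] := quot_surj u => ij; rewrite quot_complex_diffE cdiff_deg ?raddf0.
Qed.

Lemma quot_complex_diff_sq i j k u : quot_complex_diff j k (quot_complex_diff i j u) = 0.
Proof.
by have [v <-] := quot_surj u; rewrite !quot_complex_diffE cdiff_sq raddf0.
Qed.

Definition quot_complex : complex S :=
  Complex quot_complex_diff_deg quot_complex_diff_sq.

End QuotientComplex.

Section RegularElement.
Variable S : comPzRingType.

(** [Ext^1(A, B) = 0] in the form of Yoneda. *)
Definition extensions_split (A B : lmodType S) : Prop :=
  forall (E : lmodType S) (i : {linear B -> E}) (q : {linear E -> A}),
    (forall b, i b = 0 -> b = 0) -> (forall a, exists e, q e = a) ->
    (forall e, q e = 0 <-> exists b, i b = e) ->
    exists s : {linear A -> E}, forall a, q (s a) = a.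

Variables (C D : complex S) (p : chain_map C D) (a : S).
Hypothesis p_surj : surjective_map p.
Hypothesis p_ker : forall n u, p n u = 0 <-> exists v, u = a *: v.
Hypothesis a_reg : forall n (u : C n), a *: u = 0 -> u = 0.
Hypothesis a_kills : forall n (h : homology C n), a *: h = 0.

Lemma killed_boundary n (z : C n) : is_cycle z -> is_boundary (a *: z).
Proof.
move=> /cycle_represents[h zh]; apply: represents0_boundary.
by rewrite -(a_kills h); exact: represents_scale.
Qed.

(** If [p z] bounds, then [z] is, up to a boundary, [a] times a cycle, and [a]
    kills the homology of [C]. *)
Lemma homology_quotient_injection n : exists i : {linear homology C n -> homology D n},
  (forall z h, represents z h -> represents (p n z) (i h)) /\ (forall h, i h = 0 -> h = 0).
Proof.
have pc (z : C n) : is_cycle z -> is_cycle (p n z).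
  by move=> dz j; rewrite -cmap_diff dz raddf0.
have pb (z : C n) : is_boundary z -> is_boundary (p n z).
  by move=> [j [y <-]]; exists j, (p j y); rewrite cmap_diff.
have [|||i iE] := @linear_of_relation _ (homology C n) (homology D n)
  (fun h k => exists z, represents z h /\ represents (p n z) k).
- move=> b h h' k k' [z [zh zk]] [z' [zh' zk']]; exists (b *: z + z').
  by rewrite linearP; split; exact: represents_linear.
- move=> h; have [z zh] := represents_surj h.
  by have [k zk] := cycle_represents (pc _ (represents_cycle zh)); exists k, z.
- move=> k [z [zh zk]]; apply/(represents_eq zk (represents0 (boundary0 _ _))).
  by rewrite subr0; exact/pb/represents0_boundary.
exists i; split=> [z h zh|h ih].
  have [k zk] := cycle_represents (pc _ (represents_cycle zh)).
  by have /iE <- : exists z, represents z h /\ represents (p n z) k by exists z.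
have [z zh] := represents_surj h.
have [z' [zh' zk']] : exists z, represents z h /\ represents (p n z) 0 by apply/iE.
apply/(represents_eq zh' (represents0 (boundary0 _ _))); rewrite subr0.
have [j [y dy]] := represents0_boundary zk'; have [e ey] := p_surj y.
have /p_ker[v vE] : p n (z' - cdiff C j n e) = 0.
  by rewrite raddfB /= cmap_diff ey dy subrr.
rewrite -[z'](subrK (cdiff C j n e)) vE; apply: boundaryD; last by exists j, e.
apply: killed_boundary => k; apply: a_reg.
by rewrite -linearZ -vE raddfB /= cdiff_sq subr0 (represents_cycle zh').
Qed.

(** The connecting map: a cycle of [D] lifts to [c] in [C], and the boundary of
    [c] is [a] times a cycle that is unique since [a] is regular. *)
Lemma homology_quotient_connecting n (i : {linear homology C n -> homology D n}) :
  (forall z h, represents z h -> represents (p n z) (i h)) ->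
  exists q : {linear homology D n -> homology C (n - 1)},
    (forall h, exists k, q k = h) /\ (forall k, q k = 0 <-> exists h, i h = k).
Proof.
move=> iP.
pose r k h := exists c : C n, exists c' : C (n - 1),
  [/\ cdiff C n (n - 1) c = a *: c', represents (p n c) k & represents c' h].
have [|k|h [c [c' [dc /represents0_boundary[j [y dy]] c'h]]]|q qE] :=
  @linear_of_relation _ (homology D n) (homology C (n - 1)) r.
- move=> b k k' h h' [c [c' [dc ck ch]]] [e [e' [de ek eh]]].
  exists (b *: c + e), (b *: c' + e'); split.
  + by rewrite linearP dc de scalerDr !scalerA mulrC.
  + by rewrite linearP; exact: represents_linear.
  + exact: represents_linear.
- have [w wk] := represents_surj k; have [c cw] := p_surj w.
  have /p_ker[c' dc] : p (n - 1) (cdiff C n (n - 1) c) = 0.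
    by rewrite cmap_diff cw (represents_cycle wk).
  have /cycle_represents[h c'h] : is_cycle c'.
    by move=> j; apply: a_reg; rewrite -linearZ -dc cdiff_sq.
  by exists h, c, c'; rewrite cw.
- have [e ey] := p_surj y.
  have /p_ker[v vE] : p n (c - cdiff C j n e) = 0.
    by rewrite raddfB /= cmap_diff ey dy subrr.
  apply/(represents_eq c'h (represents0 (boundary0 _ _))); rewrite subr0.
  exists n, v; apply/subr0_eq/a_reg.
  by rewrite scalerBr -linearZ -vE raddfB /= cdiff_sq subr0 dc subrr.
exists q; split=> [h|k].
  have [c' c'h] := represents_surj h.
  have [c dc] := boundaryE (esym (subrK 1 n)) (killed_boundary (represents_cycle c'h)).
  have /cycle_represents[k ck] : is_cycle (p n c).
    by apply: cycleE; rewrite -cmap_diff dc; apply/p_ker; exists c'.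
  by exists k; apply/esym/qE; exists c, c'.
split=> [qk|[h <-]].
  have [c [c' [dc ck /represents0_boundary c'b]]] : r k 0 by apply/qE.
  have [e de] := boundaryE (esym (subrK 1 n)) c'b.
  have cce : is_cycle (c - a *: e).
    by apply: cycleE; rewrite raddfB /= linearZ /= dc de subrr.
  have [h ceh] := cycle_represents cce; exists h.
  apply/(represents_eq (iP _ _ ceh) ck); rewrite raddfB /= addrC addKr.
  by rewrite (_ : p n (a *: e) = 0) ?oppr0; [exact: boundary0 | apply/p_ker; exists e].
have [z zh] := represents_surj h; apply/esym/qE; exists z, 0; split.
- by rewrite scaler0 (represents_cycle zh).
- exact: iP.
- exact/represents0/boundary0.
Qed.

(** As [a] acts by zero on the homology of [C], the long exact sequence of
    [0 -> C -> C -> D -> 0] breaks up into short exact sequences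
    [0 -> H_n(C) -> H_n(D) -> H_(n-1)(C) -> 0]. *)
Lemma homology_regular_quotient n :
  extensions_split (homology C (n - 1)) (homology C n) ->
  module_iso (homology D n) (homology C n * homology C (n - 1))%type.
Proof.
have [i [iP i0]] := homology_quotient_injection n.
have [q [q_surj q_ker]] := homology_quotient_connecting iP.
move=> /(_ _ i q i0 q_surj q_ker)[s sK].
have qi h : q (i h) = 0 by apply/q_ker; exists h.
apply: (@module_iso_of_relation _ _ _
  (fun k (hh : (homology C n * homology C (n - 1))%type) => k = i hh.1 + s hh.2)).
- by move=> b k k' h h' -> ->; rewrite !linearP /= scalerDr addrACA.
- move=> k; have /q_ker[h hE] : q (k - s (q k)) = 0 by rewrite raddfB /= sK subrr.
  by exists (h, q k); rewrite /= hE subrK.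
- by move=> hh; exists (i hh.1 + s hh.2).
- move=> [h h'] /= e.
  have h'0 : h' = 0 by have := congr1 q e; rewrite raddfD /= qi sK add0r raddf0.
  by move: e; rewrite h'0 raddf0 addr0 => /esym/i0->.
- by move=> k ->; rewrite !raddf0 addr0.
Qed.

End RegularElement.

Section KoszulTower.
Variables (R : comNzRingType) (d : nat) (x : d.-tuple R) (P : complex R).

(** [P / (x_0, ..., x_(k-1)) P]. *)
Definition koszul_quotient (k : nat) : complex R :=
  @quot_complex R P (fun n => seq_submod x (P n) k)
    (fun i j u => @seq_submod_map R d x (P i) (P j) (cdiff P i j) k u).

Definition koszul_pi k n : {linear P n -> koszul_quotient k n} :=
  quot_pi (seq_submod x (P n) k).

Lemma koszul_surj k n (u : koszul_quotient k n) : exists v, koszul_pi k n v = u.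
Proof. exact: quot_surj. Qed.

Lemma koszul_pi0 k n v : koszul_pi k n v = 0 <-> v \in seq_submod x (P n) k.
Proof. exact: quot_eq0. Qed.

Lemma koszul_diffE k i j v :
  cdiff (koszul_quotient k) i j (koszul_pi k i v) = koszul_pi k j (cdiff P i j v).
Proof. exact: quot_complex_diffE. Qed.

Lemma homology_koszul0 n : module_iso (homology P n) (homology (koszul_quotient 0) n).
Proof.
have kd i j (u : P i) : koszul_pi 0 j (cdiff P i j u) =
  cdiff (koszul_quotient 0) i j (koszul_pi 0 i u) by rewrite koszul_diffE.
apply: (@complex_iso_homology _ _ _ (ChainMap kd)) => /= m u.
  by move=> /koszul_pi0/seq_submod0.
exact: koszul_surj.
Qed.

(** Each stage is the reduction of the previous one modulo the next term of [x],
    which is regular on it. *)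
Lemma homology_koszul_step (i : 'I_d) n :
  (forall m, regular_on x (P m)) ->
  (forall m (h : homology (koszul_quotient i) m), tnth x i *: h = 0) ->
  extensions_split (homology (koszul_quotient i) (n - 1)) (homology (koszul_quotient i) n) ->
  module_iso (homology (koszul_quotient i.+1) n)
    (homology (koszul_quotient i) n * homology (koszul_quotient i) (n - 1))%type.
Proof.
move=> Preg xk.
have sub m u : u \in seq_submod x (P m) i -> koszul_pi i.+1 m u = 0.
  move=> ui; apply/koszul_pi0/seq_submodS; exists 0.
  by rewrite (_ : tnth x i *: 0 = 0) ?subr0 //; exact: scaler0.
pose p m : {linear koszul_quotient i m -> koszul_quotient i.+1 m} := quot_lift (sub m).
have pE m u : p m (koszul_pi i m u) = koszul_pi i.+1 m u by exact: quot_liftE.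
have pd m j u : p j (cdiff (koszul_quotient i) m j u) =
    cdiff (koszul_quotient i.+1) m j (p m u).
  by have [v <-] := koszul_surj u; rewrite koszul_diffE !pE koszul_diffE.
have piZ m v : koszul_pi i m (tnth x i *: v) = tnth x i *: koszul_pi i m v.
  exact: linearZ_LR.
apply: (@homology_regular_quotient _ _ _ (ChainMap pd) (tnth x i)) => //=.
- by move=> m u; have [v <-] := koszul_surj u; exists (koszul_pi i m v).
- move=> m u; have [v <-] := koszul_surj u; rewrite pE; split.
    move=> /koszul_pi0/seq_submodS[w /koszul_pi0 vw]; exists (koszul_pi i m w).
    by apply: subr0_eq; rewrite -piZ -raddfB.
  move=> [w]; have [w' <-] := koszul_surj w; rewrite -piZ => e.
  apply/koszul_pi0/seq_submodS; exists w'; apply/koszul_pi0.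
  by rewrite [LHS]raddfB; apply/eqP; rewrite subr_eq0; exact/eqP.
- move=> m u; have [v <-] := koszul_surj u; rewrite -piZ => /koszul_pi0/Preg vi.
  exact/koszul_pi0.
Qed.

End KoszulTower.

(** * Vanishing of the first extension group *)

Section Ext.
Variable S : comPzRingType.

(** The vanishing of [Ext^1], computed from a projective resolution [P], against
    coefficients in [B]: cocycles [P 1 -> B] extend along the differential. *)
Definition cocycles_extend (P : complex S) (B : lmodType S) : Prop :=
  forall phi : {linear P 1 -> B}, (forall y : P 2, phi (cdiff P 2 1 y) = 0) ->
  exists psi : {linear P 0 -> B}, forall y, psi (cdiff P 1 0 y) = phi y.

Lemma Ext1_cocycles_extend (P : complex S) (B : lmodType S) :
  zero_module (Ext_via P 1 B) -> cocycles_extend P B.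
Proof.
move=> /zero_homology E0 phi phi_d.
(* The only component of a map of degree -1 into a complex concentrated in
   degree 0 is the one from degree 1. *)
pose f (p q : int) : P p -> stalk B q :=
  match p, q return P p -> stalk B q with
  | Posz 1, Posz 0 => phi
  | _, _ => fun=> 0
  end.
have [||h hE] := @mk_hom S P (stalk B) (- 1) f.
- move=> p q a u v; rewrite /f.
  case: p u v => [[|[|p]]|p] u v; rewrite ?scaler0 ?addr0 //.
  by case: q => [[|q]|q]; rewrite ?scaler0 ?addr0 // linearP.
- move=> p q u; rewrite /f.
  case: p u => [[|[|p]]|p] u //; by case: q => [[|q]|q].
have h_cycle : is_cycle (C := Hom_complex P (stalk B)) (h : Hom_complex P (stalk B) (- 1)).
  move=> m; apply: hom_ext => p q u.
  rewrite -[LHS]/(hom_diff_fun m h p q u) /hom_diff_fun; case: eqP => // _.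
  rewrite [X in X - _](_ : _ = 0) // sub0r hE.
  have -> : f (p - 1) q (cdiff P p (p - 1) u) = 0; last by rewrite scaler0 oppr0.
  have [e|p2] := eqVneq p 2.
    subst p; case: q => [[|q]|q] //=; exact: phi_d.
  rewrite /f; case: (p - 1) (cdiff P p (p - 1) u) (subrK 1 p) => [[|[|k]]|k] w // pk.
  by move: p2; rewrite -pk.
have [g gE] := boundaryE erefl (E0 _ h_cycle).
(* The differential of g is, up to sign, g composed with that of P, since the
   differential of the target vanishes. *)
have psi_lin : linear (fun y : P 0 => - ((-1) ^+ `|(- 1 + 1 : int)|%N *: g 0 0 y) : B).
  by move=> a u v; rewrite hom_linear scalerDr opprD scalerA mulrC -scalerA -scalerN.
exists (mk_linear psi_lin) => y /=.
have <- : h 1 0 y = phi y by rewrite hE.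
rewrite -gE -[RHS]/(hom_diff_fun (- 1) g 1 0 y) /hom_diff_fun eqxx.
by rewrite [X in _ = X - _](_ : _ = 0) // sub0r.
Qed.

(** The form in which the vanishing of [Ext^1] is inherited by [A]: maps from
    [A] lift along every surjection with kernel [B]. *)
Definition lifts_against (A B : lmodType S) : Prop :=
  forall (E C : lmodType S) (i : {linear B -> E}) (q : {linear E -> C})
         (f : {linear A -> C}),
    (forall b, i b = 0 -> b = 0) -> (forall c, exists e, q e = c) ->
    (forall e, q e = 0 <-> exists b, i b = e) ->
    exists g : {linear A -> E}, forall a, q (g a) = f a.

Lemma lifts_extensions_split (A B : lmodType S) : lifts_against A B -> extensions_split A B.
Proof. by move=> AB E i q i0 qs qk; have [s] := AB E A i q idfun i0 qs qk; exists s. Qed.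

(** Projectivity of [P 0] lifts [f] to [g : P 0 -> E]. On the boundaries from
    [P 1] the lift takes values in [B]; subtracting an extension of this cocycle
    to [P 0] makes [g] vanish there, so that it factors through [A]. *)
Lemma cocycles_extend_lifts (P : complex S) (A B : lmodType S) :
  projective_resolution A P -> cocycles_extend P B -> lifts_against A B.
Proof.
move=> [Pproj _ _ [e e_surj e_ker]] PB E C i q f i0 qs qk.
have [g gE] := Pproj 0 E C q (f \o e) qs.
have iK : forall y, exists b, i b = g (cdiff P 1 0 y).
  move=> y; apply/qk; rewrite gE /= (_ : e _ = 0) ?raddf0 //.
  by apply/e_ker; exists y.
have [|||phi phiE] := @linear_of_relation _ (P 1) B
  (fun y b => i b = g (cdiff P 1 0 y)).
- by move=> a y y' b b' e1 e2; rewrite !linearP e1 e2.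
- exact: iK.
- by move=> b; rewrite !raddf0 => /i0.
have iphi y : i (phi y) = g (cdiff P 1 0 y) by apply/phiE.
have [psi psiE] : exists psi : {linear P 0 -> B}, forall y, psi (cdiff P 1 0 y) = phi y.
  by apply: PB => y; apply: i0; rewrite iphi cdiff_sq raddf0.
have [|||h hE] := @linear_of_relation _ A E
  (fun a v => exists y, e y = a /\ v = g y - i (psi y)).
- move=> a u u' v v' [y [<- ->]] [y' [<- ->]]; exists (a *: y + y').
  by rewrite !linearP /= scalerDr addrACA.
- by move=> a; have [y <-] := e_surj a; exists (g y - i (psi y)), y.
- by move=> v [y [/e_ker[z <-] ->]]; rewrite psiE iphi subrr.
exists h => a; have [y ya] := e_surj a.
have <- : g y - i (psi y) = h a by apply/hE; exists y.
rewrite raddfB /= gE /= ya (_ : q _ = 0) ?subr0 //.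
by apply/qk; exists (psi y).
Qed.

(** [B] is a direct summand of a finite direct power of [T]. Such modules
    inherit the vanishing of [Ext^1] from [T] in both arguments, and the retraction
    written as a finite sum avoids the power itself. *)
Definition finite_summand (T B : lmodType S) : Prop :=
  exists (I : finType) (i : I -> {linear B -> T}) (r : I -> {linear T -> B}),
    forall b, \sum_k r k (i k b) = b.

Lemma cocycles_extend_summand (P : complex S) (T B : lmodType S) :
  finite_summand T B -> cocycles_extend P T -> cocycles_extend P B.
Proof.
move=> [I [i [r ri]]] PT phi phi_d.
have psiP k : exists psi : {linear P 0 -> T},
    forall y, psi (cdiff P 1 0 y) = i k (phi y).
  by apply: (PT (i k \o phi)) => y; rewrite /= phi_d raddf0.
have [psi psiE] := @choice _ _ _ psiP.
have lin : linear (fun y => \sum_k r k (psi k y)).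
  move=> a u v; rewrite scaler_sumr -big_split; apply: eq_bigr => k _.
  by rewrite !linearP.
exists (mk_linear lin) => y /=; rewrite -[RHS]ri.
by apply: eq_bigr => k _; rewrite psiE.
Qed.

Lemma lifts_against_summand (T A B : lmodType S) :
  finite_summand T A -> lifts_against T B -> lifts_against A B.
Proof.
move=> [I [i [r ri]]] TB E C j q f j0 qs qk.
have gP k : exists g : {linear T -> E}, forall t, q (g t) = f (r k t).
  exact: (TB E C j q (f \o r k) j0 qs qk).
have [g gE] := @choice _ _ _ gP.
have lin : linear (fun a => \sum_k g k (i k a)).
  move=> b u v; rewrite scaler_sumr -big_split; apply: eq_bigr => k _.
  by rewrite !linearP.
exists (mk_linear lin) => a /=; rewrite raddf_sum -[in RHS](ri a) raddf_sum.
by apply: eq_bigr => k _; exact: gE.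
Qed.

Lemma Ext1_extensions_split (T A B : lmodType S) : Ext_vanishes 1 T T ->
  finite_summand T A -> finite_summand T B -> extensions_split A B.
Proof.
move=> [P PT /Ext1_cocycles_extend PTT] TA TB.
apply/lifts_extensions_split/(lifts_against_summand TA)/(cocycles_extend_lifts PT).
exact: cocycles_extend_summand TB PTT.
Qed.

Lemma extensions_split_iso (A A' B B' : lmodType S) :
  module_iso A' A -> module_iso B' B -> extensions_split A B -> extensions_split A' B'.
Proof.
move=> [f [f' fK f'K]] /module_iso_sym[g [g' gK g'K]] AB E i q i0 qs qk.
have [||e|s sE] := AB E (i \o g : {linear _ -> _}) (f \o q : {linear _ -> _}).
- by move=> b /= /i0 gb; rewrite -[b]gK gb -(raddf0 g) gK.
- by move=> a; have [e eE] := qs (f' a); exists e; rewrite /= eE f'K.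
- split=> /= [fqe|[b be]].
    have /qk[b be] : q e = 0 by rewrite -[q e]fK fqe -(raddf0 f) fK.
    by exists (g' b); rewrite g'K.
  by rewrite (_ : q e = 0) ?raddf0 //; apply/qk; exists (g b).
exists (s \o f : {linear _ -> _}) => a /=; apply: (can_inj fK); exact: sE.
Qed.

Lemma zero_module_summand (T A : lmodType S) :
  finite_summand T A -> zero_module T -> zero_module A.
Proof.
move=> [I [i [r ri]]] T0 a; rewrite -(ri a) big1 // => k _.
by rewrite (T0 (i k a)) raddf0.
Qed.

Lemma finite_summand_trans (T A B : lmodType S) :
  finite_summand T A -> finite_summand A B -> finite_summand T B.
Proof.
move=> [I [i [r ri]]] [J [j [s sj]]].
exists (I * J)%type, (fun k => i k.1 \o j k.2), (fun k => s k.2 \o r k.1) => b.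
transitivity (\sum_k \sum_l s l (r k (i k (j l b)))).
  by rewrite pair_big.
rewrite exchange_big -[RHS]sj; apply: eq_bigr => l _.
by rewrite -[in RHS](ri (j l b)) raddf_sum.
Qed.

Lemma finite_summand_ffun (T : lmodType S) (I : finType) : finite_summand T {ffun I -> T}.
Proof.
have i_lin k : linear (fun f : {ffun I -> T} => f k) by move=> a f g; rewrite !ffunE.
have r_lin k : linear (fun t : T => [ffun l => if l == k then t else 0] : {ffun I -> T}).
  move=> a t u; apply/ffunP => l; rewrite !ffunE; case: eqP => //.
  by rewrite scaler0 addr0.
exists I, (fun k => mk_linear (i_lin k)), (fun k => mk_linear (r_lin k)) => f.
apply/ffunP => l; rewrite sum_ffunE (bigD1 l) //= ffunE eqxx big1 ?addr0 // => k.
by rewrite ffunE eq_sym => /negbTE->.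
Qed.

Lemma dsum_proj_linear (I : Type) (V : I -> lmodType S) i :
  linear (fun f : dsum V => dsum_val f i).
Proof. by []. Qed.

Definition dsum_proj (I : Type) (V : I -> lmodType S) i : {linear dsum V -> V i} :=
  mk_linear (@dsum_proj_linear I V i).

Lemma dsum_inj_exists (I : Type) (V : I -> lmodType S) i :
  exists j : {linear V i -> dsum V},
    (forall v, dsum_val (j v) i = v) /\ (forall v k, k <> i -> dsum_val (j v) k = 0).
Proof.
have [|||j jE] := @linear_of_relation _ (V i) (dsum V)
  (fun v f => dsum_val f i = v /\ forall k, k <> i -> dsum_val f k = 0).
- move=> a u u' v v' [e1 e2] [e3 e4]; rewrite dsumZDE e1 e3; split=> // k ki.
  by rewrite dsumZDE (e2 _ ki) (e4 _ ki) scaler0 addr0.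
- move=> v.
  pose h k : V k := if pselect (i = k) is left e then eq_rect i (fun l => V l : Type) v k e else 0.
  have hi : h i = v.
    by rewrite /h; case: pselect => // e; rewrite (Prop_irrelevance e erefl).
  have hk k : k <> i -> h k = 0 by rewrite /h; case: pselect => // e /(_ (esym e)).
  have [|f fE] := @dsum_of _ _ _ h.
    apply: (sub_finite_set (B := [set i])) => // k /= hk0; apply: contrapT => ki.
    by apply: hk0; apply: hk.
  by exists f; rewrite fE hi; split=> // k /hk; rewrite fE.
- move=> f [e1 e2]; apply: dsum_ext => k.
  by have [->|/e2->] := pselect (k = i).
exists j; split=> [v|v]; have [] := (jE v (j v)).2 erefl => //.
Qed.

Lemma finite_summand_component (I : Type) (V : I -> lmodType S) i :
  finite_summand (dsum V) (V i).
Proof.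
have [j [ji _]] := dsum_inj_exists V i.
exists 'I_1, (fun=> j), (fun=> dsum_proj V i) => v; by rewrite big_ord1 /= ji.
Qed.

Lemma finite_summand_dsum (T : lmodType S) (V : nat -> lmodType S) (K : nat) :
  (forall k, (K <= k)%N -> zero_module (V k)) ->
  (forall k, finite_summand T (V k)) -> finite_summand T (dsum V).
Proof.
move=> V0 TV.
have jP k : exists j : {linear V k -> dsum V}, (forall v, dsum_val (j v) k = v) /\
    (forall v l, l <> k -> dsum_val (j v) l = 0) by exact: dsum_inj_exists.
pose j k := projT1 (cid (jP k)).
have jE k v : dsum_val (j k v) k = v by rewrite /j; case: cid => ? [].
have j0 k v l : l <> k -> dsum_val (j k v) l = 0 by rewrite /j; case: cid => ? [? H]; exact: H.
have [I IE] := choice TV.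
have {}IE k : exists ir : (I k -> {linear V k -> T}) * (I k -> {linear T -> V k}),
    forall b, \sum_l ir.2 l (ir.1 l b) = b.
  by have [i [r ri]] := IE k; exists (i, r).
pose i k := (projT1 (cid (IE k))).1; pose r k := (projT1 (cid (IE k))).2.
have ri k b : \sum_l r k l (i k l b) = b by rewrite /r /i; case: cid => /= ? ->.
exists {k : 'I_K & I k},
  (fun s : {k : 'I_K & I k} => i (val (tag s)) (tagged s) \o dsum_proj V (val (tag s))),
  (fun s : {k : 'I_K & I k} => j (val (tag s)) \o r (val (tag s)) (tagged s)) => f.
transitivity (\sum_(k < K) \sum_(l : I k) j k (r k l (i k l (dsum_val f k)))).
  by rewrite sig_big_dep /=; apply: eq_bigr => -[].
transitivity (\sum_(k < K) j k (dsum_val f k)).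
  by apply: eq_bigr => k _; rewrite -raddf_sum ri.
apply: dsum_ext => l; rewrite dsum_sumE.
have [lK|Kl] := ltnP l K; last first.
  rewrite [RHS](V0 l Kl) big1 // => k _; apply: j0 => kl.
  by move: Kl; rewrite kl leqNgt ltn_ord.
rewrite (bigD1 (Ordinal lK)) //= jE big1 ?addr0 // => k kl; apply: j0 => lk.
by move: kl; rewrite -val_eqE /= lk eqxx.
Qed.

End Ext.

(** * Homology of the tower of quotients *)

Definition has_top (S : comPzRingType) (V : int -> lmodType S) (s : int) : Prop :=
  ~ zero_module (V s) /\ forall n, s < n -> zero_module (V n).

Section PowerSums.
Variable S : comPzRingType.
Variable X : complex S.

(** The homology of the direct sum of the complexes [Sigma^(l + k) X^(a k)],
    written in terms of the homology of [X]. *)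
Definition power_sum (l : int) (a : nat -> nat) (n : int) : lmodType S :=
  dsum (fun k : nat => {ffun 'I_(a k) -> homology X (n - (l + k%:Z))} : lmodType S).

Lemma shifted_powers_power_sum l a n :
  module_iso (dsum (fun k : nat => homology (cshift (l + k%:Z) (cpower X (a k))) n))
    (power_sum l a n).
Proof.
apply: module_iso_dsum => k.
exact: module_iso_trans (homology_cshift _ _ _) (homology_cpower _ _ _).
Qed.

(** The multiplicities of [N] plus [Sigma N] when those of [N] are [a]. *)
Definition add_shift (a : nat -> nat) (k : nat) : nat :=
  (a k + if k is j.+1 then a j else 0)%N.

Lemma power_sum_add_shift l a n :
  module_iso (power_sum l (add_shift a) n) (power_sum l a n * power_sum l a (n - 1))%type.
Proof.
apply: module_iso_trans.
  by apply: module_iso_dsum => k; exact: module_iso_ffun_add.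
apply: module_iso_trans; first exact: module_iso_dsum_prod.
apply: module_iso_prod; first exact: module_iso_refl.
apply: module_iso_trans.
  by apply: module_iso_dsum_shift; apply: zero_module_ffun; rewrite card_ord.
apply: module_iso_dsum => k; apply: module_iso_ffun.
by apply: module_iso_eq; rewrite -addn1 PoszD addrA opprD addrA addrAC.
Qed.

Lemma power_sum_killed (r : S) l a n :
  (forall m (h : homology X m), r *: h = 0) -> forall v : power_sum l a n, r *: v = 0.
Proof.
move=> rX v; apply: dsum_ext => k; apply/ffunP => i.
have /ffunP/(_ i) : dsum_val (r *: v) k = r *: dsum_val v k by [].
by rewrite !ffunE rX.
Qed.

(** The homology of [X] vanishes in low degrees, which leaves finitely many
    nonzero summands whatever the multiplicities are. *)
Lemma power_sum_finite_summand l a n :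
  bounded_homology X -> finite_summand (total_homology X) (power_sum l a n).
Proof.
move=> [lo [hi Xb]].
have X0 m : m < lo -> zero_module (homology X m).
  by move=> mlo; apply: contrapT => /Xb/andP[lom _]; move: mlo; rewrite ltNge lom.
refine (@finite_summand_dsum S _
  (fun k : nat => {ffun 'I_(a k) -> homology X (n - (l + k%:Z))})
  (absz (n - l - lo)%R).+1 _ _) => k.
  move=> kK; have Xk : zero_module (homology X (n - (l + k%:Z))).
    apply: X0; rewrite opprD addrA ltrBlDl -ltrBlDr.
    by apply: le_lt_trans (ler_norm _) _; rewrite -abszE ltz_nat.
  by move=> v; apply/ffunP => i; rewrite [RHS]ffunE; exact: Xk.
apply: finite_summand_trans (finite_summand_ffun _ _).
exact: finite_summand_component.
Qed.

End PowerSums.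

Section RestrictedHomology.
Variables (R S : comPzRingType) (f : {rmorphism R -> S}) (M : complex S).

Lemma restricted_homology_killed r n (h : homology (restrict f M) n) :
  f r = 0 -> r *: h = 0.
Proof.
move=> r0; have [z zh] := represents_surj h.
apply/(represents_eq (represents_scale r zh) (represents0 (boundary0 _ _))).
rewrite subr0 (_ : r *: z = 0); first exact: boundary0.
by rewrite -[LHS]/(f r *: (z : M n)) r0 scale0r.
Qed.

Lemma restricted_zero_homology n :
  zero_module (homology (restrict f M) n) <-> zero_module (homology M n).
Proof.
split=> [|M0]; first exact: module_iso_zero (module_iso_sym (homology_restrict f M n)).
exact: (module_iso_zero (homology_restrict f M n) M0).
Qed.

Lemma restricted_bounded_homology : bounded_homology M -> bounded_homology (restrict f M).
Proof.
move=> [lo [hi Mb]]; exists lo, hi => n n0; apply: Mb => M0; apply: n0.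
exact/restricted_zero_homology.
Qed.

Lemma restricted_power_sum l a n :
  module_iso (restr f (power_sum M l a n)) (power_sum (restrict f M) l a n).
Proof.
apply: module_iso_trans; first exact: module_iso_restr_dsum.
apply: module_iso_dsum => k.
apply: module_iso_trans; first exact: module_iso_restr_ffun.
by apply: module_iso_ffun; exact: homology_restrict.
Qed.

End RestrictedHomology.

Section KoszulHomology.
Variables (R : comNzRingType) (d : nat) (x : d.-tuple R) (P X : complex R) (l : int).
Hypothesis P_regular : forall n, regular_on x (P n).
Hypothesis x_kills : forall (i : 'I_d) n (h : homology X n), tnth x i *: h = 0.
Hypothesis X_split : forall (i : 'I_d) a n,
  extensions_split (power_sum X l a (n - 1)) (power_sum X l a n).

(** At each stage the homology is a sum of copies of that of [X], hence it is
    killed by [x] and its extensions split: the next stage adds a shifted copy. *)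
Lemma koszul_power_sum a : (forall n, module_iso (homology P n) (power_sum X l a n)) ->
  forall k, (k <= d)%N ->
  forall n, module_iso (homology (koszul_quotient x P k) n) (power_sum X l (iter k add_shift a) n).
Proof.
move=> Pa; elim=> [_ n|k IH kd n].
  exact: module_iso_trans (module_iso_sym (homology_koszul0 x P n)) (Pa n).
have {}IH := IH (ltnW kd); pose i := Ordinal kd.
have Ck m (h : homology (koszul_quotient x P i) m) : tnth x i *: h = 0.
  by apply: module_iso_killed (module_iso_sym (IH m)) _ h; apply: power_sum_killed; exact: x_kills.
apply: module_iso_trans.
  apply: (@homology_koszul_step _ _ _ _ i) => //.
  exact: (extensions_split_iso (IH _) (IH _) (@X_split i _ n)).
apply: module_iso_trans (module_iso_sym (power_sum_add_shift _ _ _ _)).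
exact: module_iso_prod.
Qed.

(** The homology in degree [n - 1] of a stage is a summand of that in degree [n]
    of the next one, so the top degree goes up by one each time. *)
Lemma koszul_top a h : (forall n, module_iso (homology P n) (power_sum X l a n)) ->
  has_top (homology P) h ->
  forall k, (k <= d)%N -> has_top (homology (koszul_quotient x P k)) (h + k%:Z).
Proof.
move=> Pa [Ph P0].
have iso0 n : module_iso (power_sum X l a n) (homology P n) by exact/module_iso_sym.
have kd_iso k n : (k <= d)%N -> module_iso (power_sum X l (iter k add_shift a) n)
    (homology (koszul_quotient x P k) n).
  by move=> kd; apply: module_iso_sym; exact: koszul_power_sum.
suff W k : has_top (power_sum X l (iter k add_shift a)) (h + k%:Z).
  move=> k kd; have [W1 W2] := W k; split=> [Z|n hn].
    exact/W1/(module_iso_zero (module_iso_sym (kd_iso k _ kd)) Z).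
  exact: module_iso_zero (kd_iso k n kd) (W2 n hn).
elim: k => [|k [W1 W2]]; rewrite ?addr0.
  split=> [/(module_iso_zero (iso0 h)) //|n hn].
  exact: module_iso_zero (Pa n) (P0 n hn).
rewrite -addn1 PoszD addrA addn1.
split=> [Z|n hn].
  apply: W1; have := module_iso_zero (power_sum_add_shift _ _ _ _) Z.
  by rewrite addrK => /zero_module_prod[].
apply: module_iso_zero (module_iso_sym (power_sum_add_shift _ _ _ _)) _.
apply/zero_module_prod; split; apply: W2; last by rewrite ltrBrDr.
by apply: lt_trans hn; rewrite ltrDl.
Qed.

Lemma add_shift_neq0 a : (exists k, a k != 0%N) -> forall k, exists j, iter k add_shift a j != 0%N.
Proof.
move=> a0; elim=> [//|k [j jk]]; exists j.
by rewrite /= /add_shift addn_eq0 negb_and jk.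
Qed.

End KoszulHomology.

(** * Descent along a surjective ring map *)

Section Descent.
Variables (R S : comPzRingType) (f : {rmorphism R -> S}).
Hypothesis f_surj : forall s, exists r, f r = s.

Definition killed_by_kernel (V : lmodType R) : Prop :=
  forall r, f r = 0 -> forall v : V, r *: v = 0.

Section DescendedModule.
Variables (V : lmodType R) (V_killed : killed_by_kernel V).

Let lift s : R := projT1 (cid (f_surj s)).

Let liftK s : f (lift s) = s.
Proof. by rewrite /lift; case: cid. Qed.

Let scale (s : S) (v : V) : V := lift s *: v.

Let scale_f r v : scale (f r) v = r *: v.
Proof.
by apply: subr0_eq; rewrite /scale -scalerBl V_killed // rmorphB /= liftK subrr.
Qed.

Let scaleA a b v : scale a (scale b v) = scale (a * b) v.
Proof. by rewrite -[a]liftK -[b]liftK -rmorphM !scale_f scalerA. Qed.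
Let scale1 : left_id 1 scale.
Proof. by move=> v; rewrite -(rmorph1 f) scale_f scale1r. Qed.
Let scaleDr : right_distributive scale +%R.
Proof. by move=> a u v; exact: scalerDr. Qed.
Let scaleDl v : {morph scale^~ v : a b / a + b}.
Proof. by move=> a b; rewrite -[a]liftK -[b]liftK -rmorphD !scale_f scalerDl. Qed.

Definition descend : lmodType S :=
  HB.pack (V : Type) (GRing.Zmodule.class V)
    (GRing.Zmodule_isLmodule.Build S V scaleA scale1 scaleDr scaleDl).

Lemma descend_scaleE r (v : descend) : f r *: v = (r *: (v : V) : V).
Proof. exact: scale_f. Qed.

End DescendedModule.

Section DescendedComplex.
Variables (D : complex R) (D_killed : forall n, killed_by_kernel (D n)).

Lemma descend_diff_subproof i j :
  linear (cdiff D i j : descend (@D_killed i) -> descend (@D_killed j)).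
Proof.
move=> s u v; have [r <-] := f_surj s.
by rewrite !descend_scaleE; exact: (linearP (cdiff D i j) r u v).
Qed.

Definition descend_complex : complex S :=
  @Complex S (fun n => descend (@D_killed n)) (fun i j => mk_linear (@descend_diff_subproof i j))
    (@cdiff_deg R D) (@cdiff_sq R D).

Lemma homology_descend n :
  module_iso (homology (restrict f descend_complex) n) (homology D n).
Proof.
have i_lin m : linear (id : restrict f descend_complex m -> D m).
  by move=> r u v; congr (_ + _); exact: (descend_scaleE (V_killed := @D_killed m)).
apply: (@complex_iso_homology R (restrict f descend_complex) D
  (@ChainMap R (restrict f descend_complex) D (fun m => mk_linear (i_lin m)) _)) => //=.
by move=> m u; exists u.
Qed.

Variables (P : complex R) (p : chain_map P D).
Hypothesis p_surj : surjective_map p.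
Hypothesis p_univ : forall n (V : lmodType S) (phi : {linear P n -> restr f V}) u,
  p n u = 0 -> phi u = 0.

Local Notation Q := descend_complex.

(** The adjunction between base change and restriction of scalars, where [D] plays
    the role of the base change of [P]; it is a relation because the two sides are
    complexes over different rings. *)
Definition hom_transpose (Z : complex S) n (h : hom Q Z n) (k : hom P (restrict f Z) n) : Prop :=
  forall i j u, k i j u = h i j (p i u).

Lemma hom_transpose_exists Z n (h : hom Q Z n) : exists k, hom_transpose h k.
Proof.
have [||k kE] := @mk_hom R P (restrict f Z) n (fun i j u => h i j (p i u)).
- move=> i j r u v; rewrite linearP -(descend_scaleE (V_killed := @D_killed i)).
  exact: (hom_linear h).
- by move=> i j u ij; rewrite hom_deg.
by exists k.
Qed.

Lemma hom_transpose_surj Z n (k : hom P (restrict f Z) n) : exists h : hom Q Z n, hom_transpose h k.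
Proof.
have sP i := surjective_section_fun (@p_surj i).
pose s i := projT1 (cid (sP i)).
have sK i : cancel (s i) (p i) by rewrite /s; case: cid.
have kE i j u u' : p i u = p i u' -> k i j u = k i j u'.
  move=> uu'; apply: subr0_eq.
  rewrite -(@p_univ _ _ (mk_linear (@hom_linear _ _ _ _ k i j)) (u - u')).
    by rewrite [RHS]raddfB.
  by rewrite raddfB /= uu' subrr.
have [||h hE] := @mk_hom S Q Z n (fun i j v => k i j (s i v)).
- move=> i j a u v; have [r <-] := f_surj a.
  have -> : k i j (s i (f r *: u + v)) = k i j (r *: s i u + s i v).
    by apply: kE; rewrite sK linearP !sK descend_scaleE.
  exact: (hom_linear k).
- by move=> i j v ij; rewrite hom_deg.
by exists h => i j u; rewrite hE; apply: kE; rewrite sK.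
Qed.

Lemma hom_transpose_diff Z n m (h : hom Q Z n) k :
  hom_transpose h k -> hom_transpose (hom_diff m h) (hom_diff m k).
Proof.
move=> hk i j u; rewrite -[LHS]/(hom_diff_fun m k i j u).
rewrite -[RHS]/(hom_diff_fun m h i j (p i u)) /hom_diff_fun; case: eqP => // _.
rewrite !hk cmap_diff -[(_ *: _ : restrict f Z j)]/(f _ *: _).
by rewrite rmorphXn /= rmorphN1.
Qed.

Lemma hom_transpose0 Z n (h : hom Q Z n) k : hom_transpose h k -> h = 0 <-> k = 0.
Proof.
move=> hk; split=> [h0|k0]; apply: hom_ext => i j u; first by rewrite hk h0.
by have [v <-] := p_surj u; rewrite -hk k0.
Qed.

Lemma hom_transpose_uniq Z n (h : hom Q Z n) k k' :
  hom_transpose h k -> hom_transpose h k' -> k = k'.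
Proof. by move=> hk hk'; apply: hom_ext => i j u; rewrite hk hk'. Qed.

Lemma hom_transpose_inj Z n (h h' : hom Q Z n) k :
  hom_transpose h k -> hom_transpose h' k -> h = h'.
Proof.
by move=> hk hk'; apply: hom_ext => i j u; have [v <-] := p_surj u; rewrite -hk -hk'.
Qed.

Lemma hom_transpose_cycle Z n (h : Hom_complex Q Z n) (k : Hom_complex P (restrict f Z) n) :
  hom_transpose h k -> is_cycle h <-> is_cycle k.
Proof.
by move=> hk; split=> dh j; have := hom_transpose_diff j hk => /hom_transpose0 E;
  apply/E; exact: dh.
Qed.

Lemma hom_transpose_boundary Z n (h : Hom_complex Q Z n) (k : Hom_complex P (restrict f Z) n) :
  hom_transpose h k -> is_boundary h <-> is_boundary k.
Proof.
move=> hk; split=> -[j [g gh]].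
  have [g' gg'] := hom_transpose_exists g; exists j, g'.
  by apply: hom_transpose_uniq hk; rewrite -gh; exact: hom_transpose_diff.
have [g' gg'] := hom_transpose_surj g; exists j, g'.
by apply: hom_transpose_inj hk; rewrite -gh; exact: hom_transpose_diff.
Qed.

Section RestrictedMap.
Variables (X Y : complex S) (b : chain_map X Y).

Definition restrict_map : chain_map (restrict f X) (restrict f Y) :=
  @ChainMap R (restrict f X) (restrict f Y) (fun n => restr_fun (f := f) (b n)) (cmap_diff b).

Lemma restrict_map_qis : quasi_iso b -> quasi_iso restrict_map.
Proof. by move=> /quasi_isoP[bi bs]; apply/quasi_isoP. Qed.

Lemma hom_transpose_map n (h : hom Q X n) k :
  hom_transpose h k -> hom_transpose (hom_map b h) (hom_map restrict_map k).
Proof. by move=> hk i j u; rewrite -[LHS]/(b j (k i j u)) hk. Qed.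

End RestrictedMap.

(** Lifting problems against [Q] over [S] are lifting problems against [P] over
    [R], by adjunction. *)
Lemma descend_semi_projective : semi_projective P -> semi_projective Q.
Proof.
move=> Psemi X Y b bs bq.
have [Hs /quasi_isoP[Hi Hq]] :=
  Psemi _ _ (restrict_map b) bs (restrict_map_qis bq).
split.
  move=> n h; have [k hk] := hom_transpose_exists h.
  have [k' kk'] := Hs n k; have [h' hk'] := hom_transpose_surj k'; exists h'.
  by apply: hom_transpose_inj hk; rewrite -kk'; exact: hom_transpose_map.
apply/quasi_isoP; split=> n h dh.
  have [k hk] := hom_transpose_exists h.
  move=> /(hom_transpose_boundary (hom_transpose_map b hk)).
  move: dh => /(hom_transpose_cycle hk) dk /(Hi n k dk).
  by move=> /(hom_transpose_boundary hk).
have [k hk] := hom_transpose_exists h.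
have [k' dk' bk'] := Hq n k ((hom_transpose_cycle hk).1 dh).
have [h' hk'] := hom_transpose_surj k'; exists h'.
  exact/(hom_transpose_cycle hk').
have T : hom_transpose (hom_map b h' - h) (hom_map (restrict_map b) k' - k).
  move=> i j u; rewrite -[LHS]/(hom_map (restrict_map b) k' i j u - k i j u).
  by rewrite (hom_transpose_map b hk') hk.
exact/(hom_transpose_boundary T).
Qed.

End DescendedComplex.
End Descent.

(** * Extremal degrees and the quasi-projective dimension *)

Section Extrema.

Lemma supremum_max d (T : porderType d) (x0 : T) (A : set T) v :
  A v -> ubound A v -> supremum x0 A = v.
Proof.
move=> Av Aub; have Asup : supremums A v by split=> // w; exact.
rewrite /supremum; case: ifPn => [/eqP A0|_]; first by move: Av; rewrite A0.
by case: xgetP => [w _ /(is_subset1_supremums Asup) //|/(_ v)].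
Qed.

Lemma infimum_min d (T : porderType d) (x0 : T) (A : set T) v :
  A v -> lbound A v -> infimum x0 A = v.
Proof.
move=> Av Alb; have Ainf : infimums A v by split=> // w; exact.
rewrite /infimum; case: ifPn => [/eqP A0|_]; first by move: Av; rewrite A0.
by case: xgetP => [w _ /(is_subset1_infimums Ainf) //|/(_ v)].
Qed.

Lemma nat_min (Q : nat -> Prop) : (exists n, Q n) ->
  exists2 n, Q n & forall m, Q m -> (n <= m)%N.
Proof.
move=> [n0 Qn0]; have Qex : exists n, `[< Q n >] by exists n0; apply/asboolP.
case: (ex_minnP Qex) => n /asboolP Qn n_min; exists n => // m Qm.
by apply/n_min/asboolP.
Qed.

Lemma int_max (Q : int -> Prop) (b : int) : (exists n, Q n) -> (forall n, Q n -> n <= b) ->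
  exists2 n, Q n & forall m, Q m -> m <= n.
Proof.
move=> [n0 Qn0] Qb.
have [|k Qk k_min] := @nat_min (fun k => Q (b - k%:Z)).
  by exists `|b - n0|%N; rewrite gez0_abs ?subr_ge0 ?Qb // subKr.
exists (b - k%:Z) => // m Qm.
have bm : 0 <= b - m by rewrite subr_ge0 Qb.
rewrite lerBrDl -lerBrDr -[b - m]gez0_abs // lez_nat.
by apply: k_min; rewrite gez0_abs // subKr.
Qed.

Lemma supremum_int (Q : int -> Prop) s : Q s -> (forall n, Q n -> n <= s) ->
  supremum -oo%E [set i%:E | i in [set i : int | Q i]] = s%:E :> \bar int.
Proof.
move=> Qs s_max; apply: supremum_max; first by exists s.
by move=> _ [n Qn <-]; rewrite lee_fin s_max.
Qed.

End Extrema.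

Section QuasiProjectiveDimension.
Variable S : comPzRingType.

Lemma has_top_le (V : int -> lmodType S) s n : has_top V s -> ~ zero_module (V n) -> n <= s.
Proof. by move=> [_ V0] nV; rewrite leNgt; apply/negP => /V0. Qed.

Lemma top_exists (V : int -> lmodType S) : (exists b : int, forall n, b < n -> zero_module (V n)) ->
  (exists n, ~ zero_module (V n)) -> exists s, has_top V s.
Proof.
move=> [b Vb] nV; have [|s Vs s_max] := @int_max (fun n => ~ zero_module (V n)) b nV.
  by move=> n nz; rewrite leNgt; apply/negP => /Vb.
exists s; split=> // n sn; apply: contrapT => /s_max.
by rewrite leNgt sn.
Qed.

Lemma sup_complex_top (P : complex S) s : has_top P s -> sup_complex P = s%:E.
Proof.
by move=> Ps; apply: supremum_int => [|n]; [exact: Ps.1 | exact: has_top_le].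
Qed.

Lemma hsup_top (P : complex S) h : has_top (homology P) h -> hsup P = h%:E.
Proof.
by move=> Ph; apply: supremum_int => [|n]; [exact: Ph.1 | exact: (has_top_le Ph)].
Qed.

Lemma tops_exist (P : complex S) : bounded_above P -> ~ exact_complex P ->
  exists s h, [/\ has_top P s, has_top (homology P) h & h <= s].
Proof.
move=> [b Pb] nP.
have [n Hn] : exists n, ~ zero_module (homology P n) by apply/existsNP.
have [h Ph] : exists h, has_top (homology P) h.
  by apply: top_exists; [exists b => m /Pb; exact: homology_zero | exists n].
have [s Ps] : exists s, has_top P s.
  by apply: top_exists; [exists b | exists n => /homology_zero].
exists s, h; split=> //; apply: (has_top_le Ps) => /homology_zero; exact: Ph.1.
Qed.

Lemma power_sum_neq0 (X : complex S) l a k m : a k != 0%N ->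
  ~ zero_module (homology X m) -> ~ zero_module (power_sum X l a (m + (l + k%:Z))).
Proof.
move=> ak Xm Z; apply: Xm.
have e : m + (l + k%:Z) - (l + k%:Z) = m by rewrite addrK.
rewrite -[m in homology X m]e => h.
have /ffunP/(_ (Ordinal (etrans (lt0n _) ak))) :=
  zero_module_summand (finite_summand_component _ k) Z [ffun=> h].
by rewrite !ffunE.
Qed.

Lemma resolution_nonexact (M P : complex S) :
  ~ exact_complex M -> quasi_projective_resolution M P -> ~ exact_complex P.
Proof.
move=> nM [_ [l [a [[k ak] Pa]]]] P0.
have [m Hm] : exists m, ~ zero_module (homology M m) by apply/existsNP.
apply: (power_sum_neq0 (l := l) ak Hm).
apply: module_iso_zero (P0 (m + (l + k%:Z))).
exact: module_iso_trans (Pa _) (shifted_powers_power_sum _ _ _ _).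
Qed.

Lemma sup_hsup_nat (P : complex S) : bounded_above P -> ~ exact_complex P ->
  exists n : nat, (sup_complex P - hsup P)%E = (n%:Z)%:E.
Proof.
move=> Pb nP; have [s [h [Ps Ph hs]]] := tops_exist Pb nP.
exists `|s - h|%N; rewrite (sup_complex_top Ps) (hsup_top Ph) -EFinB.
by rewrite gez0_abs // subr_ge0.
Qed.

(** The dimension of a nonexact complex is an infimum of natural numbers, so it
    is attained whenever some bounded above resolution exists. *)
Lemma qpd_attained (M P : complex S) : ~ exact_complex M ->
  bounded_above P -> quasi_projective_resolution M P ->
  exists Q, [/\ bounded_above Q, quasi_projective_resolution M Q,
    qpd M = (sup_complex Q - hsup Q)%E & (qpd M <= sup_complex P - hsup P)%E].
Proof.
move=> nM Pb PM.
pose dims (n : nat) := exists Q, [/\ bounded_above Q, quasi_projective_resolution M Q &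
  (n%:Z)%:E = (sup_complex Q - hsup Q)%E :> \bar int].
have dimsP Q : bounded_above Q -> quasi_projective_resolution M Q ->
    exists2 n : nat, dims n & (sup_complex Q - hsup Q)%E = (n%:Z)%:E.
  move=> Qb QM; have [n nE] := sup_hsup_nat Qb (resolution_nonexact nM QM).
  by exists n => //; exists Q.
have [n [Q [Qb QM nE]] n_min] : exists2 n, dims n & forall m, dims m -> (n <= m)%N.
  by apply: nat_min; have [n ? _] := dimsP P Pb PM; exists n.
have lb Q' : bounded_above Q' -> quasi_projective_resolution M Q' ->
    ((n%:Z)%:E <= sup_complex Q' - hsup Q')%E.
  by move=> Q'b Q'M; have [m /n_min nm ->] := dimsP Q' Q'b Q'M; rewrite lee_fin lez_nat.
have qpdE : qpd M = (n%:Z)%:E.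
  rewrite /qpd; case: asboolP => // _; apply: infimum_min; first by exists Q.
  by move=> _ [Q' [Q'b Q'M ->]]; exact: lb.
by exists Q; split; rewrite // qpdE //; exact: lb.
Qed.

Lemma qpd_finite_resolution (M : complex S) : ~ exact_complex M -> (qpd M < +oo)%E ->
  exists P, bounded_above P /\ quasi_projective_resolution M P.
Proof.
move=> nM; rewrite /qpd; case: asboolP => // _ fin; apply: contrapT => noP.
move: fin; rewrite (_ : [set v | _] = set0)%classic; first by rewrite /infimum eqxx ltxx.
by apply/seteqP; split=> v //= [P [Pb PM _]]; apply: noP; exists P.
Qed.

End QuasiProjectiveDimension.

(** * Reduction modulo the regular sequence *)

Section QuotientRing.
Variables (R : comNzRingType) (d : nat) (x : d.-tuple R) (x_regular : regular_sequence x).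

Local Notation f := (quotient_map x_regular).

Lemma quotient_map_surj s : exists r, f r = s.
Proof. by exists (repr s); rewrite /quotient_map /= reprK. Qed.

Lemma quotient_map_eq0 r : f r = 0 <-> r \in seq_ideal x d.
Proof.
have -> : (r \in seq_ideal x d) = (r == 0 %[mod quotient_ring x_regular]).
  by have := Quotient.idealrBE (regular_ideal x_regular) r 0; rewrite subr0.
split=> [r0|/eqP r0]; last by rewrite /quotient_map /= r0 -(rmorph0 f).
by apply/eqP; rewrite -[RHS](rmorph0 f) in r0.
Qed.

Lemma seq_ideal_gen (i : 'I_d) : tnth x i \in seq_ideal x d.
Proof.
apply/asboolP; exists (fun j => if j == i then 1 else 0).
rewrite (bigD1 i) //= eqxx mul1r big1 ?addr0 // => j /andP[_ /negbTE->].
by rewrite mul0r.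
Qed.

Lemma seq_ideal_sub k r : r \in seq_ideal x k -> r \in seq_ideal x d.
Proof.
move=> /asboolP[c ->]; apply/asboolP; exists (fun i : 'I_d => if (i < k)%N then c i else 0).
rewrite big_mkcond [RHS]big_mkcond; apply: eq_bigr => i _.
by rewrite ltn_ord; case: ifP => //; rewrite mul0r.
Qed.

(** If [a = a b a], then regularity of [a] modulo an ideal puts [1 - b a] into that
    ideal, so the ideal and [a] generate the whole ring. *)
Lemma von_neumann_regular_empty (i : 'I_d) : ~ von_neumann_regular R.
Proof.
move=> /(_ (tnth x i))[b xbx]; case: x_regular => xreg /negP; apply.
have xi : 1 - b * tnth x i \in seq_ideal x d.
  apply/(@seq_ideal_sub i)/xreg; rewrite mulrBr mulr1 mulrA -xbx subrr.
  by apply/asboolP; exists (fun=> 0); rewrite big1 // => j _; rewrite mul0r.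
have [_ _ closed] := seq_ideal_closed x_regular.
by have := closed b _ _ (seq_ideal_gen i) xi; rewrite addrC subrK.
Qed.

Variables (P : complex R).

Lemma koszul_quotient_killed n : killed_by_kernel f (koszul_quotient x P d n).
Proof.
move=> r /quotient_map_eq0/asboolP[c ->] v; have [u <-] := koszul_surj v.
rewrite -[LHS](linearZ_LR (koszul_pi x P d n)); apply/koszul_pi0/asboolP.
exists (fun i => c i *: u); rewrite scaler_suml; apply: eq_bigr => i _.
by rewrite scalerA mulrC.
Qed.

Lemma koszul_pi_diff i j u :
  koszul_pi x P d j (cdiff P i j u) = cdiff (koszul_quotient x P d) i j (koszul_pi x P d i u).
Proof. by rewrite koszul_diffE. Qed.

(** The base change of [P] to the quotient ring. *)
Definition reduction : complex (quotient_ring x_regular) :=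
  descend_complex quotient_map_surj koszul_quotient_killed.

Lemma reduction_semi_projective : semi_projective P -> semi_projective reduction.
Proof.
apply: (@descend_semi_projective _ _ _ _ _ _ P (ChainMap koszul_pi_diff)).
  exact: koszul_surj.
move=> n V phi u /koszul_pi0/asboolP[c ->]; rewrite raddf_sum big1 // => i _.
transitivity (tnth x i *: phi (c i)); first exact: linearZ_LR.
rewrite -[LHS]/(f (tnth x i) *: (phi (c i) : V)).
by rewrite (quotient_map_eq0 _).2 ?scale0r //; exact: seq_ideal_gen.
Qed.

Lemma reduction_zero n : zero_module (P n) -> zero_module (reduction n).
Proof.
by move=> P0 v; have [u <-] := koszul_surj v; rewrite (P0 u); exact: raddf0.
Qed.

Lemma reduction_homology n :
  module_iso (restr f (homology reduction n)) (homology (koszul_quotient x P d) n).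
Proof.
exact: module_iso_trans (homology_restrict _ _ _) (homology_descend _ _ _).
Qed.

End QuotientRing.

Section Reduction.
Variables (R : comNzRingType) (d : nat) (x : d.-tuple R) (x_regular : regular_sequence x).
Variable M : complex (quotient_ring x_regular).

Local Notation f := (quotient_map x_regular).
Local Notation M_R := (restrict f M).

Hypothesis M_split : forall (i : 'I_d) l a n,
  extensions_split (power_sum M_R l a (n - 1)) (power_sum M_R l a n).

(** The reduction vanishes wherever [P] does, so its top degree is at most that of
    [P], while the top degree of the homology goes up by [d]. *)
Lemma reduction_resolution (P : complex R) :
  ~ exact_complex M ->
  bounded_above P -> quasi_projective_resolution M_R P ->
  [/\ bounded_above (reduction x_regular P), quasi_projective_resolution M (reduction x_regular P) &
   (sup_complex (reduction x_regular P) - hsup (reduction x_regular P)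
     <= sup_complex P - hsup P - (d%:Z)%:E)%E].
Proof.
move=> nM Pb PM; have nM_R : ~ exact_complex M_R.
  by move=> M0; apply: nM => n; apply/(restricted_zero_homology f)/M0.
have nP := resolution_nonexact nM_R PM.
have [Psemi [l [a [a0 Pa]]]] := PM.
set Q := reduction x_regular P.
have Preg n : regular_on x (P n) by exact: semi_projective_regular.
have x_kills (i : 'I_d) n (h : homology M_R n) : tnth x i *: h = 0.
  by apply: restricted_homology_killed; apply/quotient_map_eq0/seq_ideal_gen.
have Pa' n : module_iso (homology P n) (power_sum M_R l a n).
  exact: module_iso_trans (Pa n) (shifted_powers_power_sum _ _ _ _).
have Ma i a' n := @M_split i l a' n.
have Qpow := koszul_power_sum Preg x_kills Ma Pa' (leqnn d).
have Qb : bounded_above Q.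
  by have [b Pb'] := Pb; exists b => n /Pb'; exact: reduction_zero.
have QM : quasi_projective_resolution M Q.
  split; first exact: reduction_semi_projective.
  exists l, (iter d add_shift a); split; first exact: add_shift_neq0.
  move=> n; apply: (module_iso_descend (@quotient_map_surj _ _ _ x_regular)).
  apply: module_iso_trans; first exact: reduction_homology.
  apply: module_iso_trans (Qpow n) _.
  apply: module_iso_trans; first exact/module_iso_sym/restricted_power_sum.
  by apply/module_iso_restr/module_iso_sym; exact: shifted_powers_power_sum.
split=> //.
have [s [h [Ps Ph hs]]] := tops_exist Pb nP.
have [s' [h' [Qs Qh _]]] := tops_exist Qb (resolution_nonexact nM QM).
have [Qh0 Qhn] := koszul_top Preg x_kills Ma Pa' Ph (leqnn d).
have Qtop : has_top (homology Q) (h + d%:Z).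
  split=> [Z|n hn].
    exact: Qh0 (module_iso_zero (reduction_homology x_regular P _) Z).
  by have := module_iso_zero (module_iso_sym (reduction_homology x_regular P n)) (Qhn n hn).
rewrite (sup_complex_top Ps) (sup_complex_top Qs) (hsup_top Ph) (hsup_top Qtop).
rewrite -!EFinB lee_fin opprD addrA lerD2r lerD2r.
by apply: (has_top_le Ps) => Ps'; apply: Qs.1; exact: reduction_zero.
Qed.

End Reduction.

Theorem theorem1p4 (R : comNzRingType) (d : nat) (x : d.-tuple R)
    (x_regular : regular_sequence x) (M : complex (quotient_ring x_regular))
    (M_bounded : bounded_homology M) (M_nonexact : ~ exact_complex M) :
  let M_R := restrict (quotient_map x_regular) M in
  (qpd M_R < +oo)%E ->
  von_neumann_regular R \/
    Ext_vanishes 1 (total_homology M_R) (total_homology M_R) ->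
  (qpd M <= qpd M_R - d%:Z%:E)%E.
Proof.
move=> M_R fin cond.
have nM_R : ~ exact_complex M_R.
  move=> M0; apply: M_nonexact => n.
  exact/(restricted_zero_homology (quotient_map x_regular))/M0.
have M_split (i : 'I_d) l a n :
    extensions_split (power_sum M_R l a (n - 1)) (power_sum M_R l a n).
  case: cond => [/(von_neumann_regular_empty x_regular i) //|ext].
  by apply: (Ext1_extensions_split ext); apply: power_sum_finite_summand;
    exact: restricted_bounded_homology.
have [P0 [P0b P0M]] := qpd_finite_resolution nM_R fin.
have [P [Pb PM -> _]] := qpd_attained nM_R P0b P0M.
have [Qb QM] := reduction_resolution M_split M_nonexact Pb PM.
apply: le_trans.
by have [_ [_ _ _]] := qpd_attained M_nonexact Qb QM.
Qed.
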